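(* Let $M$ be a finite matroid without loops or coloops, with ground set $E$, and let $\mathcal P$ be a condensation of $M$ with incidence matrix $A_{\mathcal P}$. Let $\Psi$ be a covaluative matroid invariant with values in an abelian group, and let $c(M)$ be the number of connected components of $M$. Then $$\Psi(M)=(-1)^{c(M)-1}\sum_{\hat 0=B_0<\cdots<B_k=\hat 1}\left(\prod_{i=1}^{k}-(A_{\mathcal P}^{-1})_{B_{i-1},B_i}\right)\Psi(\mathrm{Sch}_{\mathbf B}),$$ where the sum is over all strict block chains $\mathbf B=(\hat 0=B_0<B_1<\cdots<B_k=\hat 1)$ in $\mathcal P$ (of all lengths $k$). In particular, if $M$ is connected, the same Schubert formula $$\Psi(M)=\sum_{\hat 0=B_0<\cdots<B_k=\hat 1}\left(\prod_{i=1}^{k}-(A_{\mathcal P}^{-1})_{B_{i-1},B_i}\right)\Psi(\mathrm{Sch}_{\mathbf B})$$ holds both for valuative and for covaluative matroid invariants $\Psi$ with values in an abelian group.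
   Context: A flat $X$ of $M$ is cyclic if the restriction $M|X$ has no coloops. $\mathcal Z(M)$ denotes the lattice of cyclic flats of $M$, ordered by inclusion; since $M$ has no loops or coloops, $\varnothing$ and $E$ are cyclic flats. Condensation: a condensation of $M$ is a partition $\mathcal P$ of the set $\mathcal Z(M)$ into blocks such that all flats in a block have the same rank and the same cardinality, and such that for any two blocks $B,C\in\mathcal P$ every flat $Y\in C$ contains the same number of flats from $B$. This common number is $A_{\mathcal P}(B,C)=\#\{X\in B\mid X\subseteq Y\}$ for $Y\in C$. For $X\in B$ write $s_B=|X|$ and $\rho_B=\mathrm{rk}(X)$. The matrix $A_{\mathcal P}=(A_{\mathcal P}(B,C))_{B,C\in\mathcal P}$ is upper unitriangular when blocks are ordered by rank, so it is invertible over $\mathbb Z$. Write $B\le C$ when $A_{\mathcal P}(B,C)>0$; this is a partial order on $\mathcal P$. Put $\hat 0=\{\varnothing\}$ and $\hat 1=\{E\}$ (these are blocks of $\mathcal P$). Schubert matroids: a Schubert matroid is a matroid whose lattice of cyclic flats is a chain. Such a matroid without loops or coloops is determined up to isomorphism by the cardinalities and ranks of its cyclic flats. For a strict block chain $\mathbf B=(\hat 0=B_0<\cdots<B_k=\hat 1)$, $\mathrm{Sch}_{\mathbf B}$ denotes the Schubert matroid, unique up to isomorphism, on a ground set of size $|E|$ whose cyclic flats form a chain $F_0\subset F_1\subset\cdots\subset F_k$ with $|F_i|=s_{B_i}$ and $\mathrm{rk}(F_i)=\rho_{B_i}$ for $0\le i\le k$ (so $F_0=\varnothing$ and $F_k$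 is the whole ground set). Valuative and covaluative invariants: for a matroid $N$ on a finite set $S$, the base polytope $P(N)\subset\mathbb R^S$ is the convex hull of the indicator vectors of the bases of $N$. A function $\Psi$ from matroids on a fixed finite set to an abelian group is a valuation if $\sum_i a_i\Psi(N_i)=0$ whenever finitely many matroids $N_i$ on that set and $a_i\in\mathbb Z$ satisfy $\sum_i a_i\mathbf 1_{P(N_i)}=0$, where $\mathbf 1$ denotes the indicator function; it is a covaluation if $\sum_i a_i\Psi(N_i)=0$ whenever $\sum_i a_i\mathbf 1_{\mathrm{relint}\,P(N_i)}=0$, where relint denotes the relative interior. A valuative (respectively covaluative) matroid invariant is an isomorphism-invariant function on matroids whose restriction to the matroids on every fixed ground set is a valuation (respectively a covaluation). *)

(* Defs.v *)
From HB Require Import structures.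
From mathcomp Require Import all_boot all_order all_algebra.

Set Implicit Arguments.
Unset Strict Implicit.
Unset Printing Implicit Defensive.

Import Order.TTheory GRing.Theory Num.Theory.

(** * Matroids on a finite type, given by their bases *)

Definition basis_axiom (E : finType) (bs : {set {set E}}) : bool :=
  (bs != set0) &&
  [forall B1 in bs, forall B2 in bs, forall x in B1 :\: B2,
     [exists y in B2 :\: B1, (y |: (B1 :\ x)) \in bs]].

Record matroid (E : finType) := Matroid {
  bases : {set {set E}};
  basesP : basis_axiom bases
}.

HB.instance Definition _ (E : finType) := [isSub for @bases E].
HB.instance Definition _ (E : finType) := [Countable of matroid E by <:].
HB.instance Definition _ (E : finType) := [Finite of matroid E by <:].

Definition matroid_iso (S T : finType) (N : matroid S) (N' : matroid T)
    (f : S -> T) : Prop :=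
  bijective f /\ forall X : {set S}, (f @: X \in bases N') = (X \in bases N).

Section Matroid.
Variables (E : finType) (M : matroid E).
Implicit Types (X B C : {set E}) (e f : E).

Definition indep X : bool := [exists B in bases M, X \subset B].

Definition rk X : nat := \max_(B in bases M) #|B :&: X|.

Definition loopless : bool := [forall e, exists B in bases M, e \in B].
Definition coloopless : bool := [forall e, exists B in bases M, e \notin B].

Definition circuit C : bool := minset (fun D => ~~ indep D) C.

Definition same_circuit e f : bool :=
  [exists C : {set E}, [&& circuit C, e \in C & f \in C]].

(* [n_comp] counts the classes of the reflexive transitive closure; for a
   matroid, [e = f \/ same_circuit e f] is already an equivalence relation. *)
Definition n_components : nat := n_comp same_circuit E.

(* The matroid on the empty ground set, which has no component, is
   connected. *)
Definition connected : bool := n_components <= 1.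

Definition flat X : bool := [forall e, (e \notin X) ==> (rk X < rk (e |: X))].

(* The bases of the restriction M|X. *)
Definition restr_bases X : {set {set E}} :=
  [set I | maxset (fun J => indep J && (J \subset X)) I].

Definition restr_coloop X e : bool :=
  (e \in X) && [forall I in restr_bases X, e \in I].

Definition cyclic_flats : {set {set E}} :=
  [set X | flat X && [forall e, ~~ restr_coloop X e]].

(** * Condensations *)

Implicit Types (P : {set {set {set E}}}) (b c : {set {set E}}).

Definition condensation P : Prop :=
  [/\ partition P cyclic_flats,
      forall b, b \in P ->
        {in b &, forall X Y, rk X = rk Y /\ #|X| = #|Y|} &
      forall b c, b \in P -> c \in P ->
        {in c &, forall Y Y' : {set E},
           #|[set X in b | X \subset Y]| = #|[set X in b | X \subset Y']|}].

(* For a block of a condensation, none of the three definitions below depends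
   on which member [block_flat] selects. *)
Definition block_flat b : {set E} := odflt set0 [pick X in b].

Definition block_card b : nat := #|block_flat b|.
Definition block_rk b : nat := rk (block_flat b).
Definition incidence b c : nat := #|[set X in b | X \subset block_flat c]|.

Definition incidence_mx P : 'M[int]_#|P| :=
  \matrix_(i, j) (incidence (enum_val i) (enum_val j))%:Z%R.

Definition block_lt b c : bool := (b != c) && (0 < incidence b c).

(* Blocks are represented by their index in the enumeration of P. *)
Definition block_chain P k (B : {ffun 'I_k.+1 -> 'I_#|P|}) : bool :=
  [&& enum_val (B ord0) == [set set0],
      enum_val (B ord_max) == [set setT] &
      [forall i : 'I_k, block_lt (enum_val (B (widen_ord (leqnSn k) i)))
                                 (enum_val (B (lift ord0 i)))]].

Definition chain_weight P k (B : {ffun 'I_k.+1 -> 'I_#|P|}) : int :=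
  (\prod_(i < k)
     - invmx (incidence_mx P) (B (widen_ord (leqnSn k) i)) (B (lift ord0 i)))%R.

End Matroid.

(** * Schubert matroids *)

Definition is_Schubert (E : finType) (N : matroid E) k
    (s r : 'I_k.+1 -> nat) : bool :=
  [exists F : {ffun 'I_k.+1 -> {set E}},
    [&& cyclic_flats N == [set F i | i : 'I_k.+1],
        [forall i : 'I_k, F (widen_ord (leqnSn k) i) \proper F (lift ord0 i)] &
        [forall i, (#|F i| == s i) && (rk N (F i) == r i)]]].

(* For every block chain of a condensation, a matroid as required exists on E
   and is unique up to isomorphism; the default value M is then irrelevant. *)
Definition Schubert (E : finType) (M : matroid E) (P : {set {set {set E}}}) k
    (B : {ffun 'I_k.+1 -> 'I_#|P|}) : matroid E :=
  odflt M [pick N : matroid E |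
    is_Schubert N (fun i => block_card (enum_val (B i)))
                  (fun i => block_rk M (enum_val (B i)))].

(* A strict chain B_0 < ... < B_k of blocks has k < #|P|. *)
Definition Schubert_sum (G : zmodType)
    (Psi : forall S : finType, matroid S -> G)
    (E : finType) (M : matroid E) (P : {set {set {set E}}}) : G :=
  (\sum_(k < #|P|) \sum_(B : {ffun 'I_k.+1 -> 'I_#|P|} | block_chain B)
     Psi E (Schubert M B) *~ chain_weight B)%R.

(** * Valuative and covaluative invariants *)

From mathcomp Require Import boolp classical_sets reals topology normedtype.
From mathcomp Require Import numfun.
Import numFieldNormedType.Exports.

Local Open Scope classical_set_scope.
Local Open Scope ring_scope.

Section Polytope.
Variable R : realType.

Definition convex_hull n (A : set 'rV[R]_n) : set 'rV[R]_n :=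
  [set x | exists m (v : 'I_m -> 'rV[R]_n) (w : 'I_m -> R),
     [/\ forall i, A (v i), forall i, 0 <= w i, \sum_i w i = 1 &
         x = \sum_i w i *: v i]].

Definition affine_hull n (A : set 'rV[R]_n) : set 'rV[R]_n :=
  [set x | exists m (v : 'I_m -> 'rV[R]_n) (w : 'I_m -> R),
     [/\ forall i, A (v i), \sum_i w i = 1 & x = \sum_i w i *: v i]].

Definition relint n (A : set 'rV[R]_n) : set 'rV[R]_n :=
  [set x | A x /\ \forall y \near x, affine_hull A y -> A y].

(* R^S is 'rV[R]_#|S|, its coordinates being listed in the order of enum S. *)
Definition indicator_vector (S : finType) (B : {set S}) : 'rV[R]_#|S| :=
  \row_i (enum_val i \in B)%:R.

Definition base_polytope (S : finType) (N : matroid S) : set 'rV[R]_#|S| :=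
  convex_hull [set indicator_vector B | B in [set B | B \in bases N]].

Section Invariant.
Variables (G : zmodType) (Psi : forall S : finType, matroid S -> G).

Definition isomorphism_invariant : Prop :=
  forall (S T : finType) (N : matroid S) (N' : matroid T) (f : S -> T),
    matroid_iso N N' f -> Psi N = Psi N'.

Definition valuation (S : finType) : Prop :=
  forall m (N : 'I_m -> matroid S) (a : 'I_m -> int),
    (forall x, \sum_i (a i)%:~R * \1_(base_polytope (N i)) x = 0 :> R) ->
    \sum_i Psi (N i) *~ a i = 0.

Definition covaluation (S : finType) : Prop :=
  forall m (N : 'I_m -> matroid S) (a : 'I_m -> int),
    (forall x, \sum_i (a i)%:~R * \1_(relint (base_polytope (N i))) x = 0 :> R) ->
    \sum_i Psi (N i) *~ a i = 0.

Definition valuative_invariant : Prop :=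
  isomorphism_invariant /\ forall S : finType, valuation S.

Definition covaluative_invariant : Prop :=
  isomorphism_invariant /\ forall S : finType, covaluation S.

End Invariant.
End Polytope.

(* Main.v *)
Require Import Defs.
From mathcomp Require Import all_boot all_order all_algebra perm reals.
From mathcomp Require Import boolp zify ring lra.
From mathcomp Require classical_sets numfun topology normedtype.

Set Implicit Arguments.
Unset Strict Implicit.
Unset Printing Implicit Defensive.

Import Order.TTheory GRing.Theory Num.Theory.

Local Open Scope ring_scope.

(** Let Z be the lattice of cyclic flats of M and mu its Moebius function. A
    chain 0 = F_0 < ... < F_k = E in Z carries the weight
    prod_i - mu(F_(i-1), F_i), and its Schubert matroid has the F_i as cyclic
    flats, with the ranks they have in M. Everything rests on two identities
    between functions of a point x: the sum over chains of the weight times the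
    indicator of the base polytope of the Schubert matroid is the indicator of
    P(M), and the same sum with relative interiors is (-1)^(c(M)-1) times the
    indicator of relint P(M). Valuations respect the first identity, covaluations
    the second.

    To prove them, fix x with x(E) = rk E. By Edmonds' theorem [base_polytopeP],
    a point of the cube lies in a base polytope iff x(F) <= rk F for every cyclic
    flat F [rank_polytopeP]. Hence x lies in the polytope of a Schubert matroid
    iff its chain avoids the family V of the flats violated at x, and the weights
    of the chains avoiding V add up to minus the Moebius number of V with a
    bottom and a top added [avoiding_sum_moebius]. The excess x(A) - rk A is
    supermodular and its maximum is attained at some A in Z
    [excess_cyclic_flat]. If the maximum is positive, joining with A maps V to
    itself, and Weisner's theorem gives zero [avoiding_violated]. If V is
    empty, the sum is one.

    For relative interiors V consists of the proper nonempty flats with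
    x(F) >= rk F [relint_Schubert]. A positive maximal excess gives zero as
    before. Otherwise V with the empty set and E is the ring of all sets tight
    at x. A ring of sets has a nonzero Moebius number only if it is complemented
    [moebius_ring_complemented], which means here that all tight sets are unions
    of connected components, that is, that x is in the relative interior
    [relint_base_polytopeP]. In that case the tight sets form the Boolean lattice
    of all such unions, with Moebius number (-1)^c(M) [moebius_separators].

    Finally, for a condensation, the sums of mu over blocks are the entries of the
    inverse incidence matrix [block_moebius_sum]. So the weights of the chains of
    flats that run through given blocks add up to the weight of the chain of
    blocks [chain_sum_weight], and all these chains have isomorphic Schubert
    matroids [is_Schubert_iso]. *)

(* Linear arithmetic in which cardinals and ranks are opaque numbers. *)
Ltac card_lia :=
  try match goal with |- @eq _ ?a ?b => change (@eq nat a b) end;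
  repeat match goal with H : ?T |- _ =>
    lazymatch T with
    | @eq _ ?a ?b => change (@eq nat a b) in H; revert H
    | is_true (leq _ _) => revert H
    | is_true (~~ (leq _ _)) => revert H
    end end;
  clear;
  repeat match goal with
    | |- context [card ?A] => generalize (card A)
    | |- context [rk ?M ?A] => generalize (rk M A)
  end; lia.

(** * Rank and closure *)

Section Rank.
Local Open Scope nat_scope.
Variables (E : finType).
Implicit Types (M : matroid E) (A B C X Y I : {set E}) (e : E).

Lemma card_exchange B A (x y : E) : x \in B -> y \notin B ->
  #|(y |: (B :\ x)) :&: A| + (x \in A) = #|B :&: A| + (y \in A).
Proof.
move=> xB yB; have -> : (y |: B :\ x) :&: A =
    if y \in A then y |: ((B :&: A) :\ x) else (B :&: A) :\ x.
  apply/setP => z; case: ifP => yA; rewrite !inE;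
    by case: (eqVneq z y) => [->|] //=; rewrite ?yA ?andbF // -andbA.
have cx := cardsD1 x (B :&: A).
rewrite inE xB /= in cx.
case: ifP => yA; last by card_lia.
by rewrite cardsU1 !inE (negPf yB) !andbF; card_lia.
Qed.

Lemma bases_exists M : exists B : {set E}, B \in bases M.
Proof. by have /andP[/set0Pn[B BM] _] := basesP M; exists B. Qed.

Lemma bases_exchange M B1 B2 x : B1 \in bases M -> B2 \in bases M ->
  x \in B1 -> x \notin B2 ->
  exists y, [/\ y \in B2, y \notin B1 & y |: (B1 :\ x) \in bases M].
Proof.
move=> B1M B2M xB1 xB2; have /andP[_ /'forall_in_forall_inP ax] := basesP M.
have /'forall_in_existsP/(_ x) := ax _ B1M _ B2M.
rewrite inE xB1 xB2 => /(_ isT) [y]; rewrite inE => /andP[/andP[yB1 yB2] swap].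
by exists y.
Qed.

Lemma leq_rk M B X : B \in bases M -> #|B :&: X| <= rk M X.
Proof. by move=> BM; apply: (@leq_bigmax_cond _ _ (fun B => #|B :&: X|)). Qed.

Lemma rk_witness M X : exists2 B : {set E}, B \in bases M & #|B :&: X| = rk M X.
Proof.
have [B0 B0M] := bases_exists M.
rewrite /rk (bigop.bigmax_eq_arg B0) //.
by case: arg_maxnP => // B BM _; exists B.
Qed.

Lemma rk_leP M X n :
  reflect (forall B : {set E}, B \in bases M -> #|B :&: X| <= n) (rk M X <= n).
Proof. exact: bigop.bigmax_leqP. Qed.

Lemma ex_max_set (p : pred {set E}) (f : {set E} -> nat) A0 : p A0 ->
  exists A : {set E}, p A /\ forall B : {set E}, p B -> f B <= f A.
Proof. by move=> pA0; case: (arg_maxnP f pA0) => A pA maxA; exists A. Qed.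

(** Among the bases that are optimal for the smaller set, one that meets
    a fixed basis optimal for the larger set as much as possible is optimal for
    both: otherwise an exchange would move it closer to the fixed one. *)
Lemma rk_nested_witness M A C : A \subset C ->
  exists B : {set E}, [/\ B \in bases M, #|B :&: A| = rk M A & #|B :&: C| = rk M C].
Proof.
move=> sAC; have [B0 B0M B0A] := rk_witness M A; have [B2 B2M B2C] := rk_witness M C.
pose good (B : {set E}) := (B \in bases M) && (#|B :&: A| == rk M A).
have good0 : good B0 by rewrite /good B0M B0A eqxx.
have [B [/andP[BM /eqP BA] maxB]] := ex_max_set (fun B => #|B :&: B2|) good0.
exists B; split=> //; apply/eqP; rewrite eqn_leq leq_rk //= leqNgt; apply/negP => ltC.
have [x [xB xNC xNB2]] : exists x, [/\ x \in B, x \notin C & x \notin B2].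
  have : ~~ (B :\: C \subset B2 :\: C).
    apply: contraTN ltC => /subset_leq_card.
    have := cardsID C B; have := cardsID C B2.
    have eqB : #|B| = #|B2|.
      have sz X Y : X \in bases M -> Y \in bases M -> #|X| <= #|Y|.
        have [n] := ubnP #|X :\: Y|; elim: n X => // n IHn X ltn XM YM.
        have [/subset_leq_card //|/subsetPn[x xX xY]] := boolP (X \subset Y).
        have [y [yY yX swap]] := bases_exchange XM YM xX xY.
        have : #|y |: X :\ x| <= #|Y|.
          apply: IHn => //; have cY := card_exchange (~: Y) xX yX.
          by rewrite !inE yY xY /= -!setDE in cY; card_lia.
        have cT := card_exchange setT xX yX.
        by rewrite !setIT !inE in cT; card_lia.
      by apply/eqP; rewrite eqn_leq !sz.
    by card_lia.
  by case/subsetPn=> x; rewrite !inE negb_and negbK => /andP[xC xB];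
     rewrite (negPf xC) /= => xB2; exists x.
have xNA : x \notin A by apply: contra xNC; apply: (subsetP sAC).
have [y [yB2 yB BxyM]] := bases_exchange BM B2M xB xNB2.
have cA := card_exchange A xB yB; have cB2 := card_exchange B2 xB yB.
rewrite (negPf xNA) in cA; rewrite (negPf xNB2) yB2 in cB2.
have leA := leq_rk A BxyM.
have /maxB : good (y |: B :\ x) by rewrite /good BxyM; apply/eqP; card_lia.
by card_lia.
Qed.

Lemma rk0 M : rk M set0 = 0.
Proof. by apply/eqP; rewrite -leqn0; apply/rk_leP => B _; rewrite setI0 cards0. Qed.

Lemma rk_le_card M X : rk M X <= #|X|.
Proof. by apply/rk_leP => B _; apply/subset_leq_card/subsetIr. Qed.

Lemma rkS M X Y : X \subset Y -> rk M X <= rk M Y.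
Proof.
move=> sXY; apply/rk_leP => B BM; apply: leq_trans (leq_rk Y BM).
exact/subset_leq_card/setIS.
Qed.

Lemma rk_submod M X Y : rk M (X :|: Y) + rk M (X :&: Y) <= rk M X + rk M Y.
Proof.
have sIU : X :&: Y \subset X :|: Y by rewrite (subset_trans (subsetIl _ _)) ?subsetUl.
have [B [BM <- <-]] := rk_nested_witness M sIU.
rewrite setIUr setIIr cardsUI; exact: leq_add (leq_rk _ BM) (leq_rk _ BM).
Qed.

Lemma rk_basis M B : B \in bases M -> #|B| = rk M setT.
Proof.
move=> BM; have := rk_nested_witness M (subsetT B).
case=> B' [B'M]; rewrite setIT.
have -> : rk M B = #|B|.
  by apply/eqP; rewrite eqn_leq rk_le_card -{1}(setIid B) leq_rk.
move=> BB' <-; apply/eqP; rewrite eqn_leq -{1}BB' subset_leq_card ?subsetIl //=.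
have sBB' : B \subset B'.
  by apply/setIidPr/eqP; rewrite eqEcard subsetIr /= BB'.
rewrite leqNgt; apply/negP => ltBB'.
have [x xB' xB] : exists2 x, x \in B' & x \notin B.
  by apply/subsetPn; apply: contraTN ltBB' => /subset_leq_card; rewrite leqNgt.
have [y [yB yB' _]] := bases_exchange B'M BM xB' xB.
by rewrite (subsetP sBB' _ yB) in yB'.
Qed.

Lemma basesE M B : (B \in bases M) = (#|B| == rk M B) && (#|B| == rk M setT).
Proof.
apply/idP/andP => [BM|[/eqP cB /eqP cT]].
  split; last by rewrite (rk_basis BM).
  by rewrite eqn_leq rk_le_card andbT -{1}(setIid B) leq_rk.
have [B' B'M B'B] := rk_witness M B.
suff -> : B = B' by [].
have sBB' : B \subset B' by apply/setIidPr/eqP; rewrite eqEcard subsetIr B'B cB /=.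
by apply/eqP; rewrite eqEcard sBB' (rk_basis B'M) -cT /=.
Qed.

Lemma indepE M X : indep M X = (#|X| == rk M X).
Proof.
apply/'exists_in_idP/eqP => [[B BM sXB]|cX].
  apply/eqP; rewrite eqn_leq rk_le_card andbT.
  by apply: leq_trans (leq_rk X BM); rewrite (setIidPr sXB).
have [B BM BX] := rk_witness M X; exists B => //.
by apply/setIidPr/eqP; rewrite eqEcard subsetIr BX cX /=.
Qed.

Lemma flatP M X :
  reflect (forall e, e \notin X -> rk M X < rk M (e |: X)) (flat M X).
Proof. by apply: (iffP forallP) => fX e; [exact/implyP|exact/implyP/fX]. Qed.

Lemma restr_coloopE M X e :
  restr_coloop M X e = (e \in X) && (rk M (X :\ e) < rk M X).
Proof.
rewrite /restr_coloop; case: (boolP (e \in X)) => //= eX.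
apply/forall_inP/idP => [allI|ltX I].
  rewrite ltnNge; apply/negP => leX.
  have [B BM BX] := rk_witness M (X :\ e).
  have BXle := leq_rk X BM.
  have IX : B :&: X \in restr_bases M X.
    rewrite inE; apply/maxsetP; rewrite subsetIr andbT; split.
      by apply/exists_inP; exists B => //; apply: subsetIl.
    move=> J /andP[iJ sJX] sIJ; apply/eqP; rewrite eq_sym eqEcard sIJ /=.
    rewrite indepE in iJ; rewrite (eqP iJ) (leq_trans (rkS M sJX)) // (leq_trans leX) //.
    by rewrite -BX subset_leq_card // setIS // subsetDl.
  have := allI _ IX; rewrite inE eX andbT => eB.
  have := cardsD1 e (B :&: X); rewrite !inE eB eX /= -setIDA => cB.
  by card_lia.
rewrite inE => /maxsetP[/andP[iI sIX] maxI]; apply: contraTT ltX => eI.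
have [B [BM BI BX]] := rk_nested_witness M sIX.
rewrite indepE in iI; rewrite -(eqP iI) in BI.
have sIB : I \subset B by apply/setIidPr/eqP; rewrite eqEcard subsetIr BI /=.
have eqI : B :&: X = I.
  apply: maxI; last by rewrite subsetI sIB.
  by rewrite subsetIr andbT; apply/exists_inP; exists B => //; apply: subsetIl.
rewrite -leqNgt -BX eqI (eqP iI) rkS //.
by apply/subsetP => z zI; rewrite !inE (subsetP sIX) // andbT;
  apply: contraNneq eI => <-.
Qed.

Lemma cyclic_flatP M X : reflect
  ((forall e, e \notin X -> rk M X < rk M (e |: X)) /\
   (forall e, e \in X -> rk M (X :\ e) = rk M X))
  (X \in cyclic_flats M).
Proof.
rewrite inE; apply: (iffP andP) => [[/flatP fX /forallP cX]|[fX cX]]; split=> //.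
- move=> e eX; have := cX e; rewrite restr_coloopE eX /= -leqNgt => leX.
  by apply/eqP; rewrite eqn_leq leX rkS // subsetDl.
- exact/flatP.
by apply/forallP => e; rewrite restr_coloopE negb_and -leqNgt -implybE;
  apply/implyP => eX; rewrite cX.
Qed.

Lemma rk_cyclic_flat_lt M X Y : X \in cyclic_flats M -> X \proper Y -> rk M X < rk M Y.
Proof.
case/cyclic_flatP=> fX _ /properP[sXY [e eY eX]].
by apply: leq_trans (fX e eX) _; rewrite rkS // subUset sub1set eY.
Qed.

Definition rk_closure M X := [set e | rk M (e |: X) == rk M X].

Lemma sub_closure M X : X \subset rk_closure M X.
Proof. by apply/subsetP => e eX; rewrite inE (setUidPr _) ?sub1set. Qed.

Lemma rk_closureE M X : rk M (rk_closure M X) = rk M X.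
Proof.
pose p (F : {set E}) := (X \subset F) && (rk M F == rk M X).
have pX : p X by rewrite /p subxx eqxx.
have [F /maxsetP[/andP[sXF /eqP rF] maxF] _] := maxset_exists pX.
apply/eqP; rewrite eqn_leq (rkS _ (sub_closure M X)) andbT -rF rkS //.
apply/subsetP => e; rewrite inE => /eqP re; apply: contraT => eF.
suff : e |: F = F by move/setUidPr; rewrite sub1set (negPf eF).
apply: maxF; last exact: subsetUr.
rewrite /p (subset_trans sXF) ?subsetUr //= eqn_leq -{2}rF (rkS M (subsetUr _ F)) andbT.
have := rk_submod M (e |: X) F; rewrite -setUA (setUidPr sXF) re rF.
suff : rk M X <= rk M ((e |: X) :&: F) by card_lia.
by rewrite rkS // subsetI subsetUr sXF.
Qed.

(** Flats are closed in the usual sense, hence the closure of a union of two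
    cyclic flats is their join. *)
Lemma closure_sub_flat M X F : F \in cyclic_flats M -> X \subset F ->
  rk_closure M X \subset F.
Proof.
case/cyclic_flatP=> fF _ sXF; apply/subsetP => e; rewrite inE => /eqP re.
apply: contraT => eF; have := rk_submod M (e |: X) F.
rewrite -setUA (setUidPr sXF) re.
have : rk M X <= rk M ((e |: X) :&: F) by rewrite rkS // subsetI subsetUr sXF.
by have := fF e eF; card_lia.
Qed.

Lemma closure_cyclic_flat M X : (forall e, e \in X -> rk M (X :\ e) = rk M X) ->
  rk_closure M X \in cyclic_flats M.
Proof.
move=> cX; apply/cyclic_flatP; split=> e.
  move=> eC; rewrite rk_closureE; move: (eC); rewrite inE => neX.
  apply: leq_trans (rkS M (setUS [set e] (sub_closure M X))).
  by rewrite ltn_neqAle eq_sym neX rkS ?subsetUr.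
move=> eC; apply/eqP; rewrite eqn_leq rkS ?subsetDl //= rk_closureE.
have [/cX <-|eX] := boolP (e \in X); first by rewrite rkS ?setSD ?sub_closure.
rewrite rkS //; apply/subsetP => z zX; rewrite !inE (setUidPr _) ?sub1set // eqxx andbT.
by apply: contraNneq eX => <-.
Qed.

Lemma rk_noloop M : loopless M -> forall e, rk M [set e] = 1.
Proof.
move=> /forallP lM e; apply/eqP; rewrite eqn_leq.
rewrite (leq_trans (rk_le_card _ _)) ?cards1 //=.
have /exists_inP[B BM eB] := lM e.
by apply: leq_trans (leq_rk _ BM); rewrite (setIidPr _) ?cards1 ?sub1set.
Qed.

Lemma rk_nocoloop M : coloopless M -> forall e, rk M (setT :\ e) = rk M setT.
Proof.
move=> /forallP lM e; apply/eqP; rewrite eqn_leq rkS ?subsetT //=.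
have /exists_inP[B BM eB] := lM e.
apply: leq_trans (leq_rk _ BM); rewrite -(rk_basis BM) (setIidPl _) //.
by apply/subsetP => z zB; rewrite !inE andbT; apply: contraNneq eB => <-.
Qed.

Lemma set0_cyclic_flat M : loopless M -> set0 \in cyclic_flats M.
Proof.
move=> lM; apply/cyclic_flatP; split=> e; last by rewrite inE.
by rewrite rk0 setU0 rk_noloop.
Qed.

Lemma setT_cyclic_flat M : coloopless M -> setT \in cyclic_flats M.
Proof.
move=> lM; apply/cyclic_flatP; split=> e; first by rewrite inE.
by rewrite rk_nocoloop.
Qed.

Lemma join_cyclic_flat M X Y : X \in cyclic_flats M -> Y \in cyclic_flats M ->
  rk_closure M (X :|: Y) \in cyclic_flats M.
Proof.
move=> /cyclic_flatP[_ cX] /cyclic_flatP[_ cY]; apply: closure_cyclic_flat => e eXY.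
have part (Z W : {set E}) : (forall e, e \in Z -> rk M (Z :\ e) = rk M Z) -> e \in Z ->
    Z \subset W -> rk M (W :\ e) = rk M W.
  move=> cZ eZ sZW; apply/eqP; rewrite eqn_leq rkS ?subsetDl //=.
  have := rk_submod M Z (W :\ e).
  have -> : Z :|: W :\ e = W.
    apply/setP => z; rewrite !inE; case: (eqVneq z e) => [->|_] /=.
      by rewrite eZ (subsetP sZW _ eZ).
    by case: (boolP (z \in Z)) => // /(subsetP sZW).
  have -> : Z :&: (W :\ e) = Z :\ e by rewrite setIDA (setIidPl sZW).
  by rewrite cZ //; card_lia.
by move: eXY; rewrite inE => /orP[eX|eY];
  [apply: part cX eX _; apply: subsetUl | apply: part cY eY _; apply: subsetUr].
Qed.

(** The unions of connected components, by [separator_closed] and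
    [closed_separator]. *)
Definition separator M A := rk M A + rk M (~: A) == rk M setT.

Lemma separator_setC M A : separator M (~: A) = separator M A.
Proof. by rewrite /separator setCK addnC. Qed.

Lemma separatorP M A : reflect
  (forall X, rk M X = rk M (X :&: A) + rk M (X :\: A)) (separator M A).
Proof.
apply: (iffP eqP) => [sA X|sA]; last by rewrite (sA setT) setTI setTD.
have h0 := rk_submod M (X :&: A) (X :\: A).
have h1 := rk_submod M X A; have h2 := rk_submod M (X :|: A) (~: A).
have eU : X :|: A :|: ~: A = setT by rewrite -setUA setUCr setUT.
have eI : (X :|: A) :&: ~: A = X :\: A.
  by rewrite setIUl setICr setU0 setDE.
rewrite setID in h0; rewrite eU eI in h2.
by card_lia.
Qed.

Lemma separator_cyclic_flat M A : loopless M -> coloopless M -> separator M A ->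
  A \in cyclic_flats M.
Proof.
move=> lM clM /separatorP sA; apply/cyclic_flatP; split=> e eA.
  rewrite [ltnRHS]sA; have -> : (e |: A) :&: A = A by rewrite (setIidPr _) ?subsetUr.
  have -> : (e |: A) :\: A = [set e]; last by rewrite rk_noloop ?addn1.
  by apply/setP => z; rewrite !inE; case: eqVneq => [->|]; rewrite ?eA ?andbT // andNb.
have := sA (setT :\ e); have := sA setT; rewrite rk_nocoloop // => ->.
have -> : (setT :\ e) :&: A = A :\ e by rewrite setIC setIDA setIT.
have -> : (setT :\ e) :\: A = setT :\: A.
  by apply/setP => z; rewrite !inE !andbT; case: eqVneq => [->|]; rewrite ?eA ?andbT.
by rewrite setTI => /addIn.
Qed.

Lemma separator_basis M A B : B \in bases M -> separator M A -> #|B :&: A| = rk M A.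
Proof.
move=> BM /eqP sA; have := cardsID A B; rewrite (rk_basis BM) -sA setDE.
by have := leq_rk A BM; have := leq_rk (~: A) BM; card_lia.
Qed.

Lemma nonseparator_basis M A : ~~ separator M A ->
  exists2 B : {set E}, B \in bases M & #|B :&: A| < rk M A.
Proof.
move=> nA; have [B BM BA] := rk_witness M (~: A); exists B => //.
rewrite ltn_neqAle leq_rk // andbT; apply: contra nA => /eqP cA.
by rewrite /separator -(rk_basis BM) -(cardsID A B) cA setDE BA.
Qed.


(** Bases of A and of its complement are joined to an independent set: a circuit
    in their union would lie on one side. *)
Lemma closed_separator M A : closed (same_circuit M) (mem A) -> separator M A.
Proof.
move=> clA; have [B1 B1M B1A] := rk_witness M A; have [B2 B2M B2A] := rk_witness M (~: A).
pose I := (B1 :&: A) :|: (B2 :&: ~: A).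
have cI : #|I| = rk M A + rk M (~: A).
  rewrite -B1A -B2A cardsU (_ : B1 :&: A :&: (B2 :&: ~: A) = set0) ?cards0 ?subn0 //.
  by apply/setP => z; rewrite !inE; case: (z \in A); rewrite ?andbF.
suff iI : indep M I.
  rewrite /separator eqn_leq; apply/andP; split.
    by rewrite -cI; rewrite indepE in iI; rewrite (eqP iI) rkS ?subsetT.
  by have := rk_submod M A (~: A); rewrite setUCr; card_lia.
apply: contraT => dI.
have [C /[dup] circC /minsetP[dC minC] sCI] := @minset_exists _ (fun D => ~~ indep M D) I dI.
exfalso; have sub_indep (X B : {set E}) : B \in bases M -> C \subset B :&: X -> False.
  move=> BM sCB; case/negP: dC; apply/exists_inP; exists B => //.
  exact: subset_trans sCB (subsetIl _ _).
have [sC|/subsetPn[a aC aA]] := boolP (C \subset A).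
  apply: (sub_indep A B1 B1M); apply/subsetP => z zC; have := subsetP sCI z zC.
  by rewrite !inE (subsetP sC _ zC) andbF orbF.
apply: (sub_indep (~: A) B2 B2M); apply/subsetP => z zC; have := subsetP sCI z zC.
have : z \notin A.
  rewrite (_ : (z \in A) = (a \in A)) //; apply: clA.
  by apply/existsP; exists C; rewrite zC aC !andbT.
by move=> zA; rewrite !inE (negPf zA) andbF.
Qed.

(** A circuit on both sides would be the union of two independent sets whose
    ranks add up. *)
Lemma separator_closed M A : separator M A -> closed (same_circuit M) (mem A).
Proof.
move=> /separatorP sA e f /existsP[C /and3P[/minsetP[dC minC] eC fC]].
have crossing x y : x \in C -> y \in C -> x \in A -> y \notin A -> False.
  move=> xC yC xA yA; case/negP: dC; rewrite indepE eqn_leq rk_le_card andbT.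
  have i1 : indep M (C :&: A).
    apply: contraNT yA => d; have := minC _ d (subsetIl _ _) => /setIidPl.
    by move/subsetP; apply.
  have i2 : indep M (C :\: A).
    apply: contraLR xA => d; have eC' := minC _ d (subsetDl _ _).
    by move: xC; rewrite -eC' inE => /andP[].
  rewrite !indepE in i1 i2.
  by rewrite sA -(eqP i1) -(eqP i2) cardsID.
case: (boolP (f \in A)) => fA; case: (boolP (e \in A)) => eA //.
  by case: (crossing f e).
by case: (crossing e f).
Qed.

End Rank.

(** * The base polytope by inequalities *)

Section Polytope.
Variables (R : realType) (E : finType).
Implicit Types (M N : matroid E) (A B C X Y : {set E}) (e f : E) (x y : 'rV[R]_#|E|).

Definition entry x e : R := x 0 (enum_rank e).
Definition mass x A : R := \sum_(e in A) entry x e.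
Definition excess N x A : R := mass x A - (rk N A)%:R.

Lemma mass0 x : mass x set0 = 0.
Proof. by rewrite /mass big_set0. Qed.

Lemma massU1 x e A : e \notin A -> mass x (e |: A) = entry x e + mass x A.
Proof. by move=> eA; rewrite /mass big_setU1. Qed.

Lemma mass1 x e : mass x [set e] = entry x e.
Proof. by rewrite /mass big_set1. Qed.

Lemma massD1 x e A : e \in A -> mass x A = entry x e + mass x (A :\ e).
Proof. by move=> eA; rewrite /mass (big_setD1 e). Qed.

Lemma massID x A B : mass x A = mass x (A :&: B) + mass x (A :\: B).
Proof. exact: big_setID. Qed.

Lemma mass_modular x A B :
  mass x (A :|: B) + mass x (A :&: B) = mass x A + mass x B.
Proof.
rewrite (massID x (A :|: B) B) (massID x A B) setDUl setDv setU0.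
by rewrite (setIidPr (subsetUr A B)) -addrA [RHS]addrC; congr (_ + _); rewrite addrC.
Qed.

Lemma mass_ge0 x A : (forall e, 0 <= entry x e) -> 0 <= mass x A.
Proof. by move=> x0; apply: sumr_ge0. Qed.

Lemma massS x A B : (forall e, 0 <= entry x e) -> A \subset B -> mass x A <= mass x B.
Proof.
by move=> x0 sAB; rewrite (massID x B A) (setIidPr sAB) lerDl mass_ge0.
Qed.

Lemma mass_indicator B A : mass (indicator_vector R B) A = #|B :&: A|%:R.
Proof.
rewrite /mass /entry -sumr_const big_mkcond [RHS]big_mkcond /=.
by apply: eq_bigr => e _; rewrite mxE enum_rankK inE; case: (e \in B); case: (e \in A).
Qed.

Lemma entryD x y e : entry (x + y) e = entry x e + entry y e.
Proof. by rewrite /entry mxE. Qed.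

Lemma entryZ a x e : entry (a *: x) e = a * entry x e.
Proof. by rewrite /entry mxE. Qed.

Lemma massD x y A : mass (x + y) A = mass x A + mass y A.
Proof. by rewrite /mass -big_split; apply: eq_bigr => e _; apply: entryD. Qed.

Lemma massZ a x A : mass (a *: x) A = a * mass x A.
Proof. by rewrite /mass mulr_sumr; apply: eq_bigr => e _; apply: entryZ. Qed.

Lemma massN x A : mass (- x) A = - mass x A.
Proof. by rewrite -scaleN1r massZ mulN1r. Qed.

Lemma mass_sum m (w : 'I_m -> R) (v : 'I_m -> 'rV[R]_#|E|) A :
  mass (\sum_i w i *: v i) A = \sum_i w i * mass (v i) A.
Proof.
elim/big_ind2: _ => [|y1 a1 y2 a2 <- <-|i _]; last exact: massZ.
  by rewrite /mass big1 // => e _; rewrite /entry mxE.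
exact: massD.
Qed.

(** Mass is modular and rank is submodular. *)
Lemma excess_supermodular N x A B :
  excess N x A + excess N x B <= excess N x (A :|: B) + excess N x (A :&: B).
Proof.
rewrite /excess; have := mass_modular x A B.
have : (rk N (A :|: B))%:R + (rk N (A :&: B))%:R <= (rk N A)%:R + (rk N B)%:R :> R.
  by rewrite -!natrD ler_nat rk_submod.
by lra.
Qed.

(** Dropping the coloops of A and then closing never decreases the excess: a
    coloop carries at most one unit of mass and exactly one unit of rank, and the
    closure gains mass at no rank. *)
Lemma excess_cyclic_flat N x A : (forall e, 0 <= entry x e <= 1) ->
  exists2 F, F \in cyclic_flats N & excess N x A <= excess N x F.
Proof.
move=> x01; have x0 e : 0 <= entry x e by have /andP[] := x01 e.
pose p (B : {set E}) := excess N x A <= excess N x B.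
have [B /minsetP[pB minB] _] := @minset_exists _ p A (lexx _).
exists (rk_closure N B).
  apply: closure_cyclic_flat => e eB; apply/eqP; rewrite eqn_leq rkS ?subsetDl //=.
  rewrite leqNgt; apply/negP => ltr.
  have /minB : p (B :\ e).
    apply: le_trans pB _; rewrite /excess (massD1 x eB).
    have := x01 e; have : (rk N (B :\ e)).+1%:R <= (rk N B)%:R :> R by rewrite ler_nat.
    by rewrite -natr1; lra.
  by move=> /(_ (subsetDl _ _)) /setP/(_ e); rewrite !inE eqxx eB.
apply: le_trans pB _; rewrite /excess rk_closureE lerD2r massS //.
exact: sub_closure.
Qed.

Definition rank_polytope N x :=
  [/\ forall e, 0 <= entry x e, forall A, mass x A <= (rk N A)%:R
    & mass x setT = (rk N setT)%:R].

Lemma rank_polytope_le1 N x : rank_polytope N x -> forall e, 0 <= entry x e <= 1.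
Proof.
move=> [x0 xA _] e; rewrite x0 -mass1 (le_trans (xA _)) //.
by rewrite lern1 -[leqRHS](cards1 e) rk_le_card.
Qed.

Lemma rank_polytopeP N x : rank_polytope N x <->
  [/\ forall e, 0 <= entry x e <= 1, mass x setT = (rk N setT)%:R
    & forall F, F \in cyclic_flats N -> mass x F <= (rk N F)%:R].
Proof.
split=> [px|[x01 xT xF]].
  by split=> [||F _]; [apply: rank_polytope_le1 px | case: px | case: px].
split=> // [e|A]; first by have /andP[] := x01 e.
have [F FN] := excess_cyclic_flat N A x01; have := xF F FN; rewrite /excess.
by lra.
Qed.

Lemma indicator_rank_polytope N B : B \in bases N -> rank_polytope N (indicator_vector R B).
Proof.
move=> BN; split=> [e|A|]; rewrite ?mass_indicator ?setIT ?(rk_basis BN) //.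
  by rewrite /entry mxE ler0n.
by rewrite ler_nat leq_rk.
Qed.

Section Hull.
Variables (n : nat) (S : 'rV[R]_n -> Prop).

Lemma sub_convex_hull (y : 'rV[R]_n) : S y -> convex_hull S y.
Proof.
move=> Sy; exists 1%N, (fun=> y), (fun=> 1); split=> //; first by rewrite big_ord1.
by rewrite big_ord1 scale1r.
Qed.

Lemma convex_hull_segment (y z : 'rV[R]_n) (t : R) : 0 <= t <= 1 ->
  convex_hull S y -> convex_hull S z -> convex_hull S (t *: y + (1 - t) *: z).
Proof.
move=> /andP[t0 t1] [m1 [v1 [w1 [S1 p1 s1 ->]]]] [m2 [v2 [w2 [S2 p2 s2 ->]]]].
exists (m1 + m2)%N,
  (fun i => match split i with inl j => v1 j | inr j => v2 j end),
  (fun i => match split i with inl j => t * w1 j | inr j => (1 - t) * w2 j end).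
have splitl j : split (lshift m2 j) = inl j :> 'I_m1 + 'I_m2 by exact: (unsplitK (inl j)).
have splitr j : split (rshift m1 j) = inr j :> 'I_m1 + 'I_m2 by exact: (unsplitK (inr j)).
split=> [i|i||].
- by case: (split i).
- by case: (split i) => j; rewrite mulr_ge0 // subr_ge0.
- rewrite big_split_ord /=.
  under eq_bigr do rewrite splitl.
  under [X in _ + X]eq_bigr do rewrite splitr.
  by rewrite -!mulr_sumr s1 s2 !mulr1 addrC subrK.
rewrite big_split_ord /= !scaler_sumr; congr (_ + _).
  by apply: eq_bigr => j _; rewrite splitl scalerA.
by apply: eq_bigr => j _; rewrite splitr scalerA.
Qed.
End Hull.

Section Edmonds.
Variable N : matroid E.

Let tight x A := mass x A == (rk N A)%:R.
Let face_size x := (#|[set A | tight x A]| + #|[set e | entry x e == 0%R]|)%N.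

Let tightI x A B : rank_polytope N x -> tight x A -> tight x B -> tight x (A :&: B).
Proof.
move=> [_ xA _] /eqP tA /eqP tB; have := excess_supermodular N x A B.
rewrite /tight eq_le xA /= /excess; have := xA (A :|: B); rewrite tA tB.
by lra.
Qed.

Definition shift_mass x e f (t : R) : 'rV[R]_#|E| :=
  x + t *: (delta_mx 0 (enum_rank e) - delta_mx 0 (enum_rank f)).

Let entry_delta e f : entry (delta_mx 0 (enum_rank e)) f = (f == e)%:R.
Proof. by rewrite /entry mxE eqxx (inj_eq enum_rank_inj). Qed.

Let mass_delta e A : mass (delta_mx 0 (enum_rank e)) A = (e \in A)%:R.
Proof.
rewrite /mass; have [eA|eA] := boolP (e \in A).
  rewrite (bigD1 e) //= entry_delta eqxx big1 ?addr0 // => f /andP[_ /negPf fe].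
  by rewrite entry_delta fe.
by rewrite big1 // => f fA; rewrite entry_delta; case: eqVneq eA => // <-; rewrite fA.
Qed.

Let mass_shift x e f t A :
  mass (shift_mass x e f t) A = mass x A + t * ((e \in A)%:R - (f \in A)%:R).
Proof. by rewrite massD massZ massD massN !mass_delta. Qed.

Let entry_shift x e f t g :
  entry (shift_mass x e f t) g = entry x g + t * ((g == e)%:R - (g == f)%:R).
Proof. by rewrite -!mass1 mass_shift !inE ![g == _]eq_sym. Qed.

(** Moving mass from f to e keeps the tight constraints when no tight set
    separates e from f; pushing as far as possible makes a new one tight. *)
Let push x e f : rank_polytope N x -> e != f -> 0 < entry x e -> 0 < entry x f ->
  (forall A, tight x A -> (e \in A) = (f \in A)) ->
  exists t, [/\ 0 < t, rank_polytope N (shift_mass x e f t)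
              & (face_size x < face_size (shift_mass x e f t))%N].
Proof.
move=> [x0 xA xT] nef xe xf tightE.
pose sep (A : {set E}) := (e \in A) && (f \notin A).
pose slack (A : {set E}) : R := (rk N A)%:R - mass x A.
have sep1 : sep [set e] by rewrite /sep !inE eqxx eq_sym.
(* Only the constraints of sets containing e but not f become tighter. *)
have [A0 /andP[eA0 fA0] minA] : exists2 A0 : {set E}, sep A0 &
    forall A : {set E}, sep A -> slack A0 <= slack A.
  by case: (arg_minP slack sep1) => A0 sA0 minA; exists A0.
have s0 : 0 < slack A0.
  rewrite subr_gt0 lt_neqAle xA andbT; apply/negP => /tightE.
  by rewrite eA0 (negPf fA0).
pose t := Num.min (entry x f) (slack A0).
have t0 : 0 < t by rewrite /t lt_min xf s0.
have tf : t <= entry x f by rewrite /t ge_min lexx.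
have tA A : e \in A -> f \notin A -> t <= slack A.
  by move=> eA fA; rewrite /t ge_min minA ?orbT // /sep eA.
exists t; split=> //.
  split=> [g|A|].
  - rewrite entry_shift; have := x0 g.
    case: (eqVneq g e) => [ge|_]; case: (eqVneq g f) => [gf|_] //=.
    + by rewrite -ge gf eqxx in nef.
    + by lra.
    + by rewrite gf; lra.
    + by lra.
  - rewrite mass_shift; have := xA A; have := tA A; rewrite /slack.
    case: (e \in A); last by move=> _; case: (f \in A) => /=; lra.
    by case: (f \in A) => /= [_|/(_ isT isT)]; lra.
  - by rewrite mass_shift !inE subrr mulr0 addr0.
have sub1 : [set A | tight x A] \subset [set A | tight (shift_mass x e f t) A].
  apply/subsetP => A; rewrite !inE => tiA.
  by rewrite /tight mass_shift (tightE A tiA) subrr mulr0 addr0.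
have sub2 : [set g | entry x g == 0] \subset [set g | entry (shift_mass x e f t) g == 0].
  apply/subsetP => g; rewrite !inE entry_shift => /eqP xg.
  case: (eqVneq g e) => [gE|_]; first by rewrite -gE xg ltxx in xe.
  case: (eqVneq g f) => [gE|_]; first by rewrite -gE xg ltxx in xf.
  by rewrite xg subrr mulr0 addr0.
rewrite /face_size; have [ltx|lex] := ltP (entry x f) (slack A0).
  rewrite -addnS leq_add ?subset_leq_card // proper_card //.
  apply/properP; split=> //; exists f; rewrite !inE; last by rewrite gt_eqF.
  by rewrite entry_shift [f == e]eq_sym (negPf nef) eqxx /t (min_l (ltW ltx)) sub0r mulrN1 subrr.
rewrite -addSn leq_add ?subset_leq_card // proper_card //.
apply/properP; split=> //; exists A0; rewrite !inE /tight; last first.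
  by rewrite lt_eqF // -subr_gt0.
by rewrite mass_shift eA0 (negPf fA0) /t (min_r lex) subr0 mulr1 addrC subrK.
Qed.

(** A tight set meeting the fractional coordinates meets them twice, as its mass
    is an integer. *)
Let fractional_pair x : rank_polytope N x ->
  (exists e, 0 < entry x e < 1) ->
  exists e f, [/\ e != f, 0 < entry x e, 0 < entry x f &
    forall A, tight x A -> (e \in A) = (f \in A)].
Proof.
move=> px; have [x0 xA xT] := px => -[e0 e0frac].
pose T e : {set E} := \bigcap_(A | tight x A && (e \in A)) A.
have tightT e : tight x (T e).
  rewrite /T; elim/big_ind: _ => [|A B|A /andP[]//]; last exact: tightI.
  by rewrite /tight xT.
have inT e : e \in T e by apply/bigcapP => A /andP[].
have subT e A : tight x A -> e \in A -> T e \subset A.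
  by move=> tA eA; apply: bigcap_inf; rewrite tA.
pose frac e := 0 < entry x e < 1.
(* If T e is least among the T f with f fractional, then T f = T e for every
   fractional f in T e. *)
have [e fe mine] : exists2 e, frac e & forall f, frac f -> (#|T e| <= #|T f|)%N.
  by case: (arg_minnP (fun e => #|T e|) (e0frac : frac e0)) => e fe mine; exists e.
have [f] : exists f, [&& f \in T e, f != e & frac f].
  apply/existsP; apply: contraT => /pred0Pn nof; exfalso.
  have int g : g \in T e :\ e -> entry x g = (entry x g == 1)%:R.
    rewrite !inE => /andP[ge gT]; apply/eqP; apply: contraT => neg; case: nof.
    exists g; rewrite /= gT ge /frac !lt_neqAle x0.
    have /andP[_ ->] := rank_polytope_le1 px g.
    by move: neg; case: (eqVneq (entry x g) 1) => [->|_ h]; rewrite ?eqxx //= !andbT eq_sym h.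
  have /eqP := tightT e; rewrite (massD1 x (inT e)) /mass (eq_bigr _ int) -natr_sum.
  set k := (\sum_(_ in _) _)%N; move: fe => /andP[e_gt0 e_lt1] sumE.
  have h1 : (k < rk N (T e))%N by rewrite -(ltr_nat R) -sumE ltrDr.
  have : (rk N (T e) < k.+1)%N by rewrite -(ltr_nat R) -sumE -natr1 addrC ltrD2l.
  by rewrite ltnS leqNgt h1.
move=> /and3P[fT fe' ff]; exists e, f; split; rewrite 1?eq_sym //.
- by case/andP: fe.
- by case/andP: ff.
have eqT : T f = T e.
  by apply/eqP; rewrite eqEcard mine // subT.
move=> A tA; apply/idP/idP => [eA|fA].
  exact: (subsetP (subT e A tA eA)).
by apply: (subsetP (subT f A tA fA)); rewrite eqT.
Qed.

(** Edmonds' theorem: a point with a fractional entry is interior to a segment of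
    the polytope whose ends satisfy more constraints with equality, and an
    integral point is the indicator of a basis. *)
Lemma base_polytopeP x : base_polytope N x <-> rank_polytope N x.
Proof.
split=> [[m [v [w [vB w0 w1 ->]]]]|].
  have vP i : rank_polytope N (v i).
    by have [B /= BN <-] := vB i; apply: indicator_rank_polytope.
  split=> [e|A|]; rewrite -?mass1 mass_sum.
  - by apply: sumr_ge0 => i _; rewrite mulr_ge0 // mass1; have [] := vP i.
  - rewrite -[leRHS]mul1r -[X in _ <= X * _]w1 mulr_suml; apply: ler_sum => i _.
    by rewrite ler_wpM2l //; have [] := vP i.
  - rewrite -[RHS]mul1r -[X in _ = X * _]w1 mulr_suml; apply: eq_bigr => i _.
    by congr (_ * _); have [] := vP i.
have size_le y : (face_size y <= #|{set E}| + #|E|)%N by rewrite leq_add ?max_card.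
have [n] := ubnP (#|{set E}| + #|E| - face_size x)%N.
elim: n x => // n IHn x lt_n px.
have [/(fractional_pair px)[e [f [nef xe xf tightE]]]|nofrac] :=
    pselect (exists e, 0 < entry x e < 1).
  have [t [t0 pt lt_t]] := push px nef xe xf tightE.
  have tightE' A : tight x A -> (f \in A) = (e \in A) by move=> /tightE->.
  rewrite eq_sym in nef; have [s [s0 ps lt_s]] := push px nef xf xe tightE'.
  have st0 : s + t != 0 by rewrite gt_eqF ?addr_gt0.
  have -> : x = (s / (s + t)) *: shift_mass x e f t + (1 - s / (s + t)) *: shift_mass x f e s.
    apply/rowP => i; rewrite !mxE; set a : R := (_ && _)%:R; set b : R := (_ && _)%:R.
    by field.
  apply: convex_hull_segment.
  - have st := addr_gt0 s0 t0.
    by rewrite divr_ge0 ?(ltW s0) ?(ltW st) //= ler_pdivrMr // mul1r lerDl ltW.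
  - by apply: IHn => //; have := size_le (shift_mass x e f t); lia.
  - by apply: IHn => //; have := size_le (shift_mass x f e s); lia.
pose B := [set e | entry x e == 1].
have xB : x = indicator_vector R B.
  apply/rowP => i; rewrite mxE inE -[i in LHS]enum_valK -/(entry x _).
  have [x0 _ _] := px; have /andP[_ x1] := rank_polytope_le1 px (enum_val i).
  have [->//|n1] := eqVneq; apply/eqP; apply: contraT => n0; case: nofrac.
  by exists (enum_val i); rewrite !lt_neqAle x0 x1 n1 eq_sym n0.
apply: sub_convex_hull; exists B => //=; have [_ xA xT] := px.
move: xT (xA B); rewrite xB !mass_indicator setIT setIid => /eqP.
rewrite eqr_nat ler_nat basesE => /eqP cB leB.
by rewrite [in X in _ && X]cB eqxx andbT eqn_leq leB rk_le_card.
Qed.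

End Edmonds.
End Polytope.

(** * The relative interior of the base polytope *)

Section RelativeInterior.
Import topology normedtype numFieldNormedType.Exports.
Variables (R : realType) (E : finType) (N : matroid E).
Implicit Types (A B : {set E}) (e : E) (x y : 'rV[R]_#|E|).

Lemma ex_pos_lower_bound (T : finType) (f : T -> R) :
  exists2 d, 0 < d & forall t, 0 < f t -> d <= f t.
Proof.
pose g (o : option T) := if o is Some t then f t else 1.
have g0 : 0 < g None by exact: ltr01.
have [o go mino] : exists2 o, 0 < g o & forall o', 0 < g o' -> g o <= g o'.
  by case: (arg_minP (P := fun o => 0 < g o) g g0) => o go mino; exists o.
by exists (g o) => // t ft; apply: (mino (Some t)).
Qed.

Lemma ball_entry x y d : 0 < d ->
  ball x d y <-> forall e, `|entry y e - entry x e| < d.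
Proof.
move=> d0; split=> [b e|b]; first by rewrite distrC; apply: (b.2 0 (enum_rank e)).
split=> // i j; rewrite (ord1 i) /= /ball /= distrC.
by have := b (enum_val j); rewrite /entry enum_valK.
Qed.

Lemma mass_affine_hull A y : separator N A ->
  affine_hull (base_polytope N) y -> mass y A = (rk N A)%:R.
Proof.
move=> sA [m [v [w [vP w1 ->]]]]; rewrite mass_sum.
rewrite -[RHS]mul1r -[X in _ = X * _]w1 mulr_suml; apply: eq_bigr => i _.
congr (_ * _); have [m' [v' [w' [vB' _ w1' ->]]]] := vP i; rewrite mass_sum.
rewrite -[RHS]mul1r -[X in _ = X * _]w1' mulr_suml; apply: eq_bigr => j _.
by congr (_ * _); have [B /= BN <-] := vB' j; rewrite mass_indicator (separator_basis BN).
Qed.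

Hypothesis lN : loopless N.

(** A point with a tight constraint that some basis satisfies strictly can be
    moved out of the polytope, along the line through that basis, without
    leaving the affine hull. *)
Lemma relint_push x B : relint (base_polytope N) x -> B \in bases N ->
  exists2 t : R, 0 < t & rank_polytope N (x + t *: (x - indicator_vector R B)).
Proof.
move=> [/base_polytopeP px /nbhs_ballP[d /= d0 sub]] BN.
have [x0 _ _] := px; have x1 := rank_polytope_le1 px.
exists (d / 2); first by rewrite divr_gt0.
apply/base_polytopeP/sub.
  apply/ball_entry => [//|e]; rewrite entryD addrC addKr entryZ normrM.
  rewrite gtr0_norm ?divr_gt0 // (@le_lt_trans _ _ (d / 2)) //; last by lra.
  rewrite ger_pMr ?divr_gt0 // /entry !mxE enum_rankK -/(entry x e).
  by have := x1 e; case: (e \in B) => /=; rewrite ler_norml => ?; lra.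
exists 2, (fun i => if i == 0 then x else indicator_vector R B),
  (fun i => if i == 0 then 1 + d / 2 else - (d / 2)).
split; last first.
- by rewrite !big_ord_recl big_ord0 /= addr0 scalerBr scalerDl scale1r scaleNr addrA.
- by rewrite !big_ord_recl big_ord0 /= addr0 addrK.
move=> i; case: ifP => _; first exact/base_polytopeP.
by apply/base_polytopeP/indicator_rank_polytope.
Qed.

(** The constraints that hold with equality on the whole polytope are those of
    the separators; the remaining ones are finitely many open conditions. *)
Lemma relint_base_polytopeP x : relint (base_polytope N) x <->
  [/\ rank_polytope N x, forall e, 0 < entry x e &
      forall A, mass x A = (rk N A)%:R -> separator N A].
Proof.
split=> [rx|[px xpos xsep]].
  have /base_polytopeP px := rx.1; split=> // [e|A xA].
    have [x0 _ _] := px; rewrite lt_neqAle x0 andbT; apply/eqP => xe.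
    have /forallP/(_ e)/exists_inP[B BN eB] := lN.
    have [t t0 [/(_ e)]] := relint_push rx BN.
    rewrite entryD entryZ -xe /entry !mxE enum_rankK eB -/(entry x e) -xe => + _ _.
    by rewrite mulr1n; lra.
  apply: contraT => /nonseparator_basis[B BN ltB].
  have [t t0 [_ /(_ A)]] := relint_push rx BN.
  rewrite massD massZ massD massN mass_indicator xA -(ltr_nat R) in ltB *.
  by rewrite gerDl pmulr_rle0 // subr_le0 leNgt ltB.
split; first exact/base_polytopeP.
have [x0 xA xT] := px.
have [d1 d1_gt0 d1P] := ex_pos_lower_bound (entry x).
have [d2 d2_gt0 d2P] := ex_pos_lower_bound (fun A => (rk N A)%:R - mass x A).
pose d := Num.min d1 (d2 / #|E|.+1%:R).
have d_gt0 : 0 < d by rewrite lt_min d1_gt0 divr_gt0.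
apply/nbhs_ballP; exists d => //= y /(ball_entry _ _ d_gt0) by_ aff; apply/base_polytopeP.
have bound e : `|entry y e - entry x e| < d1 /\
    `|entry y e - entry x e| < d2 / #|E|.+1%:R.
  by have := by_ e; rewrite lt_min => /andP.
split=> [e|A|].
- have [+ _] := bound e; have := d1P e (xpos e); rewrite ltr_norml => ? /andP[]; lra.
- have [sA|nA] := boolP (separator N A); first by rewrite (mass_affine_hull sA aff).
  have : 0 < (rk N A)%:R - mass x A.
    by rewrite subr_gt0 lt_neqAle xA andbT; apply: contra nA => /eqP/xsep.
  move=> /d2P; suff : mass (y - x) A <= d2 by rewrite massD massN; lra.
  apply: (@le_trans _ _ (\sum_(e in A) d2 / #|E|.+1%:R)).
    apply: ler_sum => e _; rewrite entryD -[entry (- x) e]mass1 massN mass1.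
    by have [_ /ltW] := bound e; rewrite ler_norml => /andP[].
  rewrite sumr_const -[_ *+ #|A|]mulr_natr -mulrA -[leRHS]mulr1 ler_pM2l //.
  by rewrite mulrC ler_pdivrMr // mul1r ler_nat (leq_trans (max_card _)).
by apply: mass_affine_hull aff; rewrite /separator setCT rk0 addn0.
Qed.

Lemma tight_separator_lt1 x : coloopless N -> rank_polytope N x ->
  (forall A, mass x A = (rk N A)%:R -> separator N A) -> forall e, entry x e < 1.
Proof.
move=> clN px xsep e; rewrite lt_neqAle; have /andP[_ ->] := rank_polytope_le1 px e.
rewrite andbT; apply/eqP => xe; have := xsep [set e].
rewrite mass1 xe rk_noloop // => /(_ erefl) se.
have /cyclic_flatP[_ /(_ e (set11 e))] := separator_cyclic_flat lN clN se.
by rewrite setDv rk0 rk_noloop.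
Qed.

End RelativeInterior.

(** * Schubert matroids of chains of cyclic flats *)

Section SchubertMatroid.
Local Open Scope nat_scope.
Variables (E : finType) (M : matroid E) (D : {set {set E}}).
Implicit Types (A B F G H : {set E}).

Definition Schubert_bases : {set {set E}} :=
  [set B : {set E} | (#|B| == rk M setT) && [forall F in D, #|B :&: F| <= rk M F]].

Definition Schubert_matroid : matroid E := insubd M Schubert_bases.

Hypothesis chainD : {in D &, forall F G, (F \subset G) || (G \subset F)}.
Hypothesis D0 : set0 \in D.

Lemma Schubert_basesP B : reflect
  (#|B| = rk M setT /\ forall F, F \in D -> #|B :&: F| <= rk M F)
  (B \in Schubert_bases).
Proof.
rewrite inE; apply: (iffP andP) => [[/eqP cB /forall_inP leB]|[cB leB]] //.
by split; [rewrite cB | apply/forall_inP].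
Qed.

Lemma sub_Schubert_bases B : B \in bases M -> B \in Schubert_bases.
Proof.
move=> BM; apply/Schubert_basesP; split; first by rewrite (rk_basis BM).
by move=> F _; apply: leq_rk.
Qed.

Lemma exchange_Schubert_bases B (x y : E) : B \in Schubert_bases ->
  x \in B -> y \notin B ->
  (y |: (B :\ x) \in Schubert_bases) =
  [forall F in D, [&& x \notin F & #|B :&: F| == rk M F] ==> (y \notin F)].
Proof.
move=> /Schubert_basesP[cB leB] xB yB; have cT := card_exchange setT xB yB.
rewrite !inE !setIT !addn1 in cT; case: cT => cT.
rewrite inE cT cB eqxx /=; apply: eq_forallb_in => F FD.
have := leB F FD; have := card_exchange F xB yB.
set a := #|_ :&: F|; set b := #|_ :&: F|.
by case: (x \in F); case: (y \in F) => /=; lia.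
Qed.

(** The sets of D missing x that block an exchange removing x from B form a
    chain, so one of them contains the others. *)
Lemma max_saturated B (x : E) : exists H,
  [/\ H \in D, #|B :&: H| = rk M H, x \notin H & forall F, F \in D ->
    #|B :&: F| = rk M F -> x \notin F -> F \subset H].
Proof.
pose q H := [&& H \in D, #|B :&: H| == rk M H & x \notin H].
have q0 : q set0 by rewrite /q D0 setI0 cards0 rk0 inE eqxx.
have [H [/and3P[HD /eqP cH xH] maxH]] := ex_max_set (fun H => #|H|) q0.
exists H; split=> // F FD cF xF; have /orP[//|sHF] := chainD FD HD.
have /maxH : q F by rewrite /q FD cF eqxx.
by move=> leF; rewrite (eqP (_ : H == F)) // eqEcard sHF.
Qed.

(** The new element is chosen outside the largest saturated set that misses the
    element removed: every other saturated set missing it is contained there. *)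
Lemma Schubert_basis_axiom : basis_axiom Schubert_bases.
Proof.
apply/andP; split.
  by apply/set0Pn; have [B BM] := bases_exists M; exists B; apply: sub_Schubert_bases.
apply/forall_inP => B1 B1S; apply/forall_inP => B2 B2S; apply/forall_inP => x.
rewrite inE => /andP[xB2 xB1]; have [H [HD cH xH maxH]] := max_saturated B1 x.
have [c1 _] := Schubert_basesP _ B1S; have [c2 le2] := Schubert_basesP _ B2S.
have [y yB2 yB1] : exists2 y, y \in B2 :\: H & y \notin B1 :\: H.
  apply/subsetPn; apply/negP => sB.
  have : B2 :\: H \proper B1 :\: H.
    by apply/properP; split=> //; exists x; rewrite !inE ?xH ?xB1 // negb_and xB2 orbT.
  move/proper_card; have := le2 H HD; rewrite -cH.
  by have := cardsID H B1; have := cardsID H B2; card_lia.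
move: yB2 yB1; rewrite !inE => /andP[yH yB2]; rewrite yH /= => yB1.
apply/exists_inP; exists y; first by rewrite inE yB1.
rewrite exchange_Schubert_bases //; apply/forall_inP => F FD; apply/implyP.
by case/andP=> xF /eqP cF; apply: contra yH; apply/subsetP/maxH.
Qed.

Let N := Schubert_matroid.

Lemma bases_Schubert : bases N = Schubert_bases.
Proof. exact/insubdK/Schubert_basis_axiom. Qed.

Lemma rk_Schubert_ge A : rk M A <= rk N A.
Proof.
have [B BM <-] := rk_witness M A; apply: leq_rk.
by rewrite bases_Schubert sub_Schubert_bases.
Qed.

Lemma rk_SchubertT : rk N setT = rk M setT.
Proof.
have [B BM] := bases_exists M; rewrite -(rk_basis BM); apply/esym/rk_basis.
by rewrite bases_Schubert sub_Schubert_bases.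
Qed.

Lemma rk_Schubert F : F \in D -> rk N F = rk M F.
Proof.
move=> FD; apply/eqP; rewrite eqn_leq rk_Schubert_ge andbT; apply/rk_leP => B.
by rewrite bases_Schubert => /Schubert_basesP[_ /(_ F FD)].
Qed.

Lemma loopless_Schubert : loopless M -> loopless N.
Proof.
move=> /forallP lM; apply/forallP => e; have /exists_inP[B BM eB] := lM e.
by apply/exists_inP; exists B => //; rewrite bases_Schubert sub_Schubert_bases.
Qed.

Lemma coloopless_Schubert : coloopless M -> coloopless N.
Proof.
move=> /forallP lM; apply/forallP => e; have /exists_inP[B BM eB] := lM e.
by apply/exists_inP; exists B => //; rewrite bases_Schubert sub_Schubert_bases.
Qed.

Hypothesis DT : setT \in D.

(** If B is a basis meeting A in rank many elements, no exchange of an element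
    of B outside A for one of A outside B is possible, so each such exchange is
    blocked by a saturated set; by the chain condition one of them blocks all. *)
Lemma rk_Schubert_formula A :
  exists2 F, F \in D & rk N A = rk M F + #|A :\: F|.
Proof.
have [B BN cBA] := rk_witness N A; have := BN; rewrite bases_Schubert => BS.
have [cB leB] := Schubert_basesP _ BS.
(* The least saturated set G containing the rest of A works. *)
pose p G := [&& G \in D, #|B :&: G| == rk M G & A :\: B \subset G].
have pT : p setT by rewrite /p DT setIT cB eqxx subsetT.
have [G [/and3P[GD /eqP cG sG] minG]] : exists G, p G /\ forall H, p H -> #|G| <= #|H|.
  by case: (arg_minnP (fun G : {set E} => #|G|) pT) => G pG minG; exists G.
exists G => //.
suff sBG : B :&: G \subset A.
  have sAG : A :\: G \subset B.
    apply/subsetP => z; rewrite inE => /andP[zG zA]; apply: contraR zG => zB.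
    by rewrite (subsetP sG) // inE zB.
  rewrite -cBA -cG -(cardsID G (B :&: A)).
  by rewrite setIAC (setIidPl sBG) -setIDA (setIidPr sAG).
apply/subsetP => x; rewrite inE => /andP[xB xG]; apply: contraT => xA.
have [H [HD cH xH maxH]] := max_saturated B x.
have pH : p H.
  rewrite /p HD cH eqxx /=; apply/subsetP => y; rewrite inE => /andP[yB yA].
  have : y |: (B :\ x) \notin Schubert_bases.
    rewrite -bases_Schubert; apply/negP => swapN; have := leq_rk A swapN.
    by have := card_exchange A xB yB; rewrite -cBA yA (negPf xA); card_lia.
  rewrite exchange_Schubert_bases // => /forall_inPn[F FD].
  rewrite negb_imply negbK => /andP[/andP[xF /eqP cF] yF].
  exact: (subsetP (maxH F FD cF xF)).
have := minG H pH; have /orP[sGH|sHG] := chainD GD HD.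
  by rewrite (subsetP sGH) in xH.
rewrite leqNgt proper_card //; apply/properP; split=> //; by exists x.
Qed.

Hypothesis D_cyclic : {subset D <= cyclic_flats M}.

(** If the rank formula for a cyclic flat A uses F in D, the elements of A outside
    F are coloops of A, so A is contained in F and has the same rank. *)
Lemma cyclic_flats_Schubert : cyclic_flats N = D.
Proof.
apply/setP => A; apply/cyclic_flatP/idP => [[fA cA]|AD].
  have [F FD rA] := rk_Schubert_formula A.
  have sAF : A \subset F.
    apply/subsetP => e eA; apply: contraT => eF.
    have := rk_submod N F ((A :\ e) :\: F); have := rk_le_card N ((A :\ e) :\: F).
    have : rk N (A :\ e) <= rk N (F :|: (A :\ e) :\: F).
      apply: rkS; apply/subsetP => z zA; rewrite in_setU in_setD.
      by case: (z \in F).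
    rewrite cA // rA (rk_Schubert FD) [A :\ e :\: F]setDDl [[set e] :|: F]setUC -setDDl.
    by have := cardsD1 e (A :\: F); rewrite inE eF eA /=; card_lia.
  suff -> : A = F by [].
  apply/eqP; rewrite eqEsubset sAF; apply/subsetP => e eF; apply: contraT => /fA.
  rewrite rA (_ : A :\: F = set0) ?cards0 ?addn0; last by apply/eqP; rewrite setD_eq0.
  by rewrite -(rk_Schubert FD) ltnNge rkS // subUset sub1set eF.
have /cyclic_flatP[fA cA] := D_cyclic AD; split=> e eA.
  by rewrite rk_Schubert // (leq_trans (fA e eA)) ?rk_Schubert_ge.
apply/eqP; rewrite eqn_leq rkS ?subsetDl //= rk_Schubert // -(cA e eA).
exact: rk_Schubert_ge.
Qed.

End SchubertMatroid.

(** * Uniqueness of Schubert matroids *)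

Section Uniqueness.
Local Open Scope nat_scope.
Variable E : finType.

Lemma ex_perm_of_levels (f g : E -> nat) :
  (forall m, #|[set e | m <= f e]| = #|[set e | m <= g e]|) ->
  exists s : {perm E}, forall e, g (s e) = f e.
Proof.
move=> fg; have cfg m : #|[set e | f e == m]| = #|[set e | g e == m]|.
  have split_level h : #|[set e : E | h e == m]| + #|[set e | m < h e]| = #|[set e | m <= h e]|.
    rewrite -[RHS](cardsID [set e | m < h e]) addnC; congr (_ + _); apply: eq_card => e.
      by rewrite !inE; case: (ltngtP m (h e)).
    by rewrite !inE; case: (ltngtP m (h e)).
  by have := split_level f; have := split_level g; rewrite !fg; lia.
have /tuple_permP[p eq_p] : perm_eq [tuple f (enum_val i) | i < #|E|]
                                    [tuple g (enum_val i) | i < #|E|].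
  apply/allP => m _ /=; apply/eqP.
  have cnt (h : E -> nat) :
      count_mem m [seq h (enum_val i) | i <- enum 'I_#|E|] = #|[set e | h e == m]|.
    rewrite count_map -sum1_count big_enum_cond -[RHS]sum1_card.
    by rewrite [RHS](reindex _ (onW_bij _ (@enum_val_bij E))); apply: eq_bigl => i; rewrite !inE.
  by rewrite !cnt cfg.
have inj : injective (fun e => enum_val (p (enum_rank e))).
  by move=> a b /enum_val_inj /perm_inj /enum_rank_inj.
exists (perm inj) => e; rewrite permE.
have := congr1 (fun t => tnth t (enum_rank e)) (val_inj eq_p).
by rewrite !tnth_mktuple enum_rankK.
Qed.

Lemma chain_monotone k (F : 'I_k.+1 -> {set E}) :
  (forall i : 'I_k, F (widen_ord (leqnSn k) i) \subset F (lift ord0 i)) ->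
  forall i j : 'I_k.+1, i <= j -> F i \subset F j.
Proof.
move=> FS i j; have [n] := ubnP j; elim: n j => // n IHn j ltjn.
rewrite leq_eqVlt => /predU1P[/val_inj->//|ltij].
have j0 : 0 < j by apply: leq_ltn_trans ltij.
have ltjk : j.-1 < k by have := ltn_ord j; lia.
have eqj : j = lift ord0 (Ordinal ltjk) by apply: val_inj; rewrite /= /bump /=; lia.
apply: subset_trans (_ : F (widen_ord (leqnSn k) (Ordinal ltjk)) \subset _).
  by apply: IHn => /=; lia.
by rewrite [in X in _ \subset F X]eqj.
Qed.

(** The level of an element is determined by the smallest flat of the chain
    containing it; chains with the same cardinalities have equally many elements
    at each level. *)
Lemma ex_perm_of_chains k (F F' : 'I_k.+1 -> {set E}) :
  (forall i j : 'I_k.+1, i <= j -> F i \subset F j) ->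
  (forall i j : 'I_k.+1, i <= j -> F' i \subset F' j) ->
  (forall i, #|F i| = #|F' i|) ->
  exists s : {perm E}, forall i e, (s e \in F' i) = (e \in F i).
Proof.
move=> FS FS' cF.
(* Positions are counted from the top, so that membership in the i-th flat
   reads as a lower bound on the level. *)
pose level (G : 'I_k.+1 -> {set E}) e := \max_(i | e \in G i) (k.+1 - i).
have levelP (G : 'I_k.+1 -> {set E}) : (forall i j : 'I_k.+1, i <= j -> G i \subset G j) ->
    forall (i : 'I_k.+1) e, (k.+1 - i <= level G e) = (e \in G i).
  move=> GS i e; apply/idP/idP => [le_i|eGi].
    have : 0 < level G e by apply: leq_trans le_i; rewrite subn_gt0.
    case: (pickP (fun j => e \in G j)) => [j0 ej0 _|none]; last by rewrite /level big_pred0.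
    move: le_i; rewrite /level (bigop.bigmax_eq_arg j0) //.
    case: arg_maxnP => // j ej _ le_ij; apply: subsetP ej; apply: GS.
    by have := ltn_ord j; have := ltn_ord i; lia.
  exact: (@leq_bigmax_cond _ _ (fun j : 'I_k.+1 => k.+1 - j)).
have [s sE] : exists s : {perm E}, forall e, level F' (s e) = level F e.
  apply: ex_perm_of_levels => m.
  have [->|m0] := posnP m; first by apply: eq_card => e; rewrite !inE.
  have [lem|ltm] := leqP m k.+1.
    have lti : k.+1 - m < k.+1 by lia.
    have tail (G : 'I_k.+1 -> {set E}) : (forall i j : 'I_k.+1, i <= j -> G i \subset G j) ->
        [set e | m <= level G e] = G (Ordinal lti).
      by move=> GS; apply/setP => e; rewrite inE -levelP //=; congr (_ <= _); lia.
    by rewrite !tail.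
  have tail (G : 'I_k.+1 -> {set E}) : [set e | m <= level G e] = set0.
    apply/setP => e; rewrite !inE; apply/negbTE; rewrite -ltnNge (leq_ltn_trans _ ltm) //.
    by apply/bigop.bigmax_leqP => i _; rewrite leq_subr.
  by rewrite !tail.
by exists s => i e; rewrite -!levelP // sE.
Qed.

(** The excess of B at its own indicator is |B| - rk B, and it is bounded by the
    excess of a cyclic flat. *)
Lemma bases_cyclic_flats (R : realType) (N : matroid E) (B : {set E}) :
  (B \in bases N) = (#|B| == rk N setT) && [forall F in cyclic_flats N, #|B :&: F| <= rk N F].
Proof.
apply/idP/andP => [BN|[cB /forall_inP leB]].
  by rewrite (rk_basis BN); split=> //; apply/forall_inP => F _; apply: leq_rk.
rewrite basesE cB andbT eqn_leq rk_le_card andbT.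
have b01 e : (0 <= entry (indicator_vector R B) e <= 1)%R.
  by rewrite /entry mxE; case: (_ \in B); rewrite ?ler01 ?lexx.
have [F /leB leF] := excess_cyclic_flat N B b01.
rewrite /excess !mass_indicator setIid -(ler_nat R) => h.
by move: leF; rewrite -(ler_nat R); lra.
Qed.

Lemma is_Schubert_iso (R : realType) (N N' : matroid E) k (s r : 'I_k.+1 -> nat) :
  is_Schubert N s r -> is_Schubert N' s r -> s ord_max = #|E| ->
  exists f : E -> E, matroid_iso N N' f.
Proof.
move=> /existsP[F /and3P[/eqP cN /forallP chF /forallP srF]].
move=> /existsP[F' /and3P[/eqP cN' /forallP chF' /forallP srF']] sT.
have cardF i : #|F i| = #|F' i|.
  by have /andP[/eqP-> _] := srF i; have /andP[/eqP-> _] := srF' i.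
have rkF i : rk N (F i) = rk N' (F' i).
  by have /andP[_ /eqP->] := srF i; have /andP[_ /eqP->] := srF' i.
have FT : F ord_max = setT.
  apply/eqP; rewrite eqEcard subsetT cardsT -sT.
  by have /andP[/eqP-> _] /= := srF ord_max.
have FT' : F' ord_max = setT.
  by apply/eqP; rewrite eqEcard subsetT cardsT -sT -cardF; have /andP[/eqP-> _] /= := srF ord_max.
have [p pF] := ex_perm_of_chains (chain_monotone (fun i => proper_sub (chF i)))
                                 (chain_monotone (fun i => proper_sub (chF' i))) cardF.
exists p; split; first by exists (p^-1)%g; [exact: permK | exact: permKV].
have rT : rk N setT = rk N' setT by rewrite -{1}FT rkF FT'.
move=> X; rewrite !(bases_cyclic_flats R) (card_imset _ perm_inj) rT; congr (_ && _).
have cap i : #|p @: X :&: F' i| = #|X :&: F i|.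
  rewrite -[RHS](card_imset _ (@perm_inj _ p)); apply: eq_card => e; rewrite inE.
  apply/andP/imsetP => [[/imsetP[a aX ->]]|[a]].
    by rewrite pF => aF; exists a; rewrite // inE aX.
  by rewrite inE => /andP[aX aF] ->; rewrite pF; split=> //; apply: imset_f.
apply/forall_inP/forall_inP => h G; rewrite ?cN ?cN' => /imsetP[i _ ->].
  by rewrite -cap rkF; apply: h; rewrite cN' imset_f.
by rewrite cap -rkF; apply: h; rewrite cN imset_f.
Qed.

End Uniqueness.

(** * Moebius functions and weighted chains *)

Section Moebius.
Variables (T : finType) (le : rel T).
Hypotheses (le_refl : reflexive le) (le_anti : antisymmetric le) (le_trans : transitive le).

(** Fuel n suffices at x as soon as at most n elements lie above x. *)
Fixpoint moebius_rec n (x y : T) : int :=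
  if n is m.+1 then (x == y)%:R - \sum_(z | le x z && (z != x)) moebius_rec m z y else 0.

Definition moebius := moebius_rec #|T|.

Lemma card_up_lt x z : le x z -> z != x -> (#|[pred t | le z t]| < #|[pred t | le x t]|)%N.
Proof.
move=> xz nzx; apply/proper_card/properP; split.
  by apply/subsetP => t; rewrite !inE; apply: le_trans.
exists x; rewrite !inE ?le_refl //; apply: contra nzx => zx.
by apply/eqP/le_anti; rewrite zx xz.
Qed.

Lemma moebius_rec_stable n m x y : (#|[pred t | le x t]| <= n)%N ->
  (#|[pred t | le x t]| <= m)%N -> moebius_rec n x y = moebius_rec m x y.
Proof.
have up_gt0 z : (0 < #|[pred t | le z t]|)%N by apply/card_gt0P; exists z; rewrite inE.
elim: n m x => [|n IHn] [|m] x; rewrite ?(leqNgt _ 0) ?up_gt0 // => ltn ltm /=.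
congr (_ - _); apply: eq_bigr => z /andP[xz nzx]; have := card_up_lt xz nzx.
by move=> lt_z; apply: IHn; rewrite -ltnS (leq_trans lt_z).
Qed.

Lemma moebiusE x y : moebius x y = (x == y)%:R - \sum_(z | le x z && (z != x)) moebius z y.
Proof.
rewrite {1}/moebius; case eqT: {1}#|T| => [|m] /=; first by have := fintype0 x eqT.
congr (_ - _); apply: eq_bigr => z /andP[xz nzx].
have lt_z := leq_trans (card_up_lt xz nzx) (max_card _).
by apply: moebius_rec_stable; [rewrite -ltnS -eqT | exact: max_card].
Qed.

Lemma moebius_suml x y : \sum_(z | le x z) moebius z y = (x == y)%:R.
Proof. by rewrite (bigD1 x) //= moebiusE subrK. Qed.

(** The two Moebius relations say that the matrix of the Moebius function is a
    right, resp. left, inverse of the zeta matrix. *)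
Lemma moebius_sumr x y : \sum_(z | le z y) moebius x z = (x == y)%:R.
Proof.
pose Z : 'M[int]_#|T| := \matrix_(i, j) (le (enum_val i) (enum_val j))%:R.
pose U : 'M[int]_#|T| := \matrix_(i, j) moebius (enum_val i) (enum_val j).
have toT (F : T -> int) : \sum_(i < #|T|) F (enum_val i) = \sum_z F z.
  by rewrite [RHS](reindex _ (onW_bij _ (@enum_val_bij T))).
have ZU : Z *m U = 1%:M.
  apply/matrixP => i j; rewrite !mxE -(inj_eq enum_val_inj) -moebius_suml.
  rewrite [RHS]big_mkcond -toT; apply: eq_bigr => k _; rewrite !mxE.
  by case: le; rewrite ?mul1r ?mul0r.
have /matrixP/(_ (enum_rank x) (enum_rank y)) := mulmx1C ZU.
rewrite !mxE (inj_eq enum_rank_inj) => <-; rewrite big_mkcond -toT; apply: eq_bigr => k _.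
by rewrite !mxE !enum_rankK; case: le; rewrite ?mulr1 ?mulr0.
Qed.

Lemma moebius_triangular x y : ~~ le x y -> moebius x y = 0.
Proof.
have [n] := ubnP #|[pred t | le x t]|; elim: n x => // n IHn x ltn nxy.
rewrite moebiusE big1 => [|z /andP[xz nzx]].
  by rewrite subr0; case: eqVneq nxy => // ->; rewrite le_refl.
apply: IHn; first exact: leq_trans (card_up_lt xz nzx) ltn.
by apply: contra nxy; apply: le_trans.
Qed.

Lemma moebius_diag x : moebius x x = 1.
Proof.
rewrite moebiusE eqxx big1 ?subr0 // => z /andP[xz nzx]; apply: moebius_triangular.
by apply: contra nzx => zx; apply/eqP/le_anti; rewrite zx xz.
Qed.

End Moebius.

Section ChainSums.
Variables (T : finType) (w : T -> T -> int).
Implicit Types (Q : nat -> {set T}).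

Definition weight k (F : {ffun 'I_k.+1 -> T}) : int :=
  \prod_(i < k) w (F (widen_ord (leqnSn k) i)) (F (lift ord0 i)).

Definition chain_in (Q : nat -> {set T}) k (F : {ffun 'I_k.+1 -> T}) : bool :=
  [forall i : 'I_k.+1, F i \in Q i].

Definition chain_sum (Q : nat -> {set T}) k (y : T) : int :=
  \sum_(F : {ffun 'I_k.+1 -> T} | chain_in Q F && (F ord_max == y)) weight F.

Lemma chain_sum_notin Q k y : y \notin Q k -> chain_sum Q k y = 0.
Proof.
move=> yQ; rewrite /chain_sum big1 // => F /andP[/forallP/(_ ord_max) FQ /eqP Fy].
by rewrite -Fy FQ in yQ.
Qed.

Lemma chain_sum0 Q y : chain_sum Q 0 y = (y \in Q 0%N)%:R.
Proof.
have [yQ|yQ] := boolP (y \in Q 0%N); last exact: chain_sum_notin.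
rewrite /chain_sum (big_pred1 [ffun=> y]); first by rewrite /weight big_ord0.
move=> F; apply/andP/eqP => [[_ /eqP Fy]|->].
  by apply/ffunP => i; rewrite ffunE -Fy (ord1 i); congr (F _); apply: val_inj.
by split; [apply/forallP => i; rewrite ffunE (ord1 i) | rewrite ffunE].
Qed.

Definition extend_chain k (F : {ffun 'I_k.+1 -> T}) y : {ffun 'I_k.+2 -> T} :=
  [ffun i : 'I_k.+2 => if (i < k.+1)%N then F (inord i) else y].

Lemma extend_chainE k (F : {ffun 'I_k.+1 -> T}) y (i : 'I_k.+1) (j : 'I_k.+2) :
  j = i :> nat -> extend_chain F y j = F i.
Proof. by move=> ji; rewrite ffunE ji ltn_ord inord_val. Qed.

Lemma extend_chain_max k (F : {ffun 'I_k.+1 -> T}) y : extend_chain F y ord_max = y.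
Proof. by rewrite ffunE ltnn. Qed.

Lemma weight_extend_chain k (F : {ffun 'I_k.+1 -> T}) y :
  weight (extend_chain F y) = weight F * w (F ord_max) y.
Proof.
rewrite /weight big_ord_recr /=; congr (_ * w _ _).
- apply: eq_bigr => i _; congr (w _ _); apply: extend_chainE => //.
- exact: extend_chainE.
by rewrite -[RHS](extend_chain_max F); congr (extend_chain F y _); apply: val_inj.
Qed.

Lemma chain_sumS Q k y : y \in Q k.+1 ->
  chain_sum Q k.+1 y = \sum_x chain_sum Q k x * w x y.
Proof.
move=> yQ.
transitivity (\sum_(F : {ffun 'I_k.+1 -> T} | chain_in Q F) weight F * w (F ord_max) y).
  pose restr (F : {ffun 'I_k.+2 -> T}) : {ffun 'I_k.+1 -> T} :=
    [ffun i => F (widen_ord (leqnSn k.+1) i)].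
  rewrite /chain_sum (reindex_onto (fun F : {ffun 'I_k.+1 -> T} => extend_chain F y) restr)
    => [|F /andP[_ /eqP Fy]].
    apply: eq_big => [F|F _]; last exact: weight_extend_chain.
    rewrite extend_chain_max eqxx andbT; apply/andP/forallP => [[/forallP FQ _] i|FQ].
      by have := FQ (widen_ord (leqnSn k.+1) i); rewrite (@extend_chainE _ _ _ i).
    split.
      apply/forallP => i; rewrite ffunE; case: ltnP => [lti|lei].
        by have := FQ (inord i); rewrite inordK.
      by have -> : i = k.+1 :> nat by apply/eqP; rewrite eqn_leq lei -ltnS ltn_ord.
    by apply/eqP/ffunP => i; rewrite ffunE (@extend_chainE _ _ _ i).
  apply/ffunP => i; rewrite ffunE; case: ltnP => [lti|lei].
    by rewrite ffunE; congr (F _); apply: val_inj; rewrite /= inordK.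
  rewrite -Fy; congr (F _); apply: val_inj => /=.
  by apply/eqP; rewrite eqn_leq lei -ltnS ltn_ord.
rewrite (partition_big (fun F : {ffun 'I_k.+1 -> T} => F ord_max) xpredT) //=.
apply: eq_bigr => x _; rewrite /chain_sum mulr_suml; apply: eq_bigr => F /andP[_ /eqP-> //].
Qed.

(** The flats of a chain are summed out from the bottom upwards: those of one
    block contribute a factor that depends only on the next block. *)
Lemma chain_sum_blocks (Q : nat -> {set T}) (a : nat -> int) k :
  (forall i y, (i < k)%N -> y \in Q i.+1 -> \sum_(x in Q i) w x y = a i) ->
  forall y, y \in Q k -> chain_sum Q k y = \prod_(i < k) a i.
Proof.
elim: k => [|k IHk] Qa y yQ; first by rewrite chain_sum0 yQ big_ord0.
rewrite chain_sumS // big_ord_recr /= -(Qa k y) // mulr_sumr [RHS]big_mkcond /=.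
apply: eq_bigr => x _; case: ifP => [xQ|/negbT xQ].
  by rewrite IHk // => i z lti; apply: Qa; apply: leqW.
by rewrite chain_sum_notin ?mul0r.
Qed.

End ChainSums.

(** * Moebius numbers of families of sets *)

Section SetFamilies.
Variable E : finType.
Implicit Types (A X Y : {set E}) (L : {set {set E}}) (g : {set E} -> int).

(** Weisner's theorem: grouping the subsets of Y according to their join with A
    gives partial sums that vanish one after the other. *)
Lemma Weisner L g A (j : {set E} -> {set E}) :
  (forall X, X \in L -> [/\ j X \in L, X \subset j X & A \subset j X]) ->
  (forall X Y, X \in L -> Y \in L -> X \subset Y -> A \subset Y -> j X \subset Y) ->
  (forall Y, Y \in L -> A \subset Y -> \sum_(X in L | X \subset Y) g X = 0) ->
  forall Y, Y \in L -> A \subset Y -> \sum_(X in L | j X == Y) g X = 0.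
Proof.
move=> jL jmin gL Y; have [n] := ubnP #|Y|; elim: n Y => // n IHn Y ltn YL sAY.
have /eqP := gL Y YL sAY.
rewrite (partition_big j (fun Z => [&& Z \in L, A \subset Z & Z \subset Y])) => [|X]; last first.
  by case/andP=> XL sXY; have [-> _ ->] := jL X XL; rewrite jmin.
rewrite (bigD1 Y) ?YL ?sAY ?subxx //= [X in _ + X]big1 ?addr0 => [/eqP eq0|Z].
  rewrite -[RHS]eq0; apply: eq_bigl => X; case XL: (X \in L) => //=.
  by case: eqVneq => [<-|]; rewrite ?andbF // andbT; have [_ -> _] := jL X XL.
move=> /andP[/and3P[ZL sAZ sZY] nZY].
have ltZ : (#|Z| < #|Y|)%N by rewrite proper_card // properEneq nZY.
rewrite -[RHS](IHn Z _ ZL sAZ); last exact: leq_trans ltZ ltn.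
apply: eq_bigl => X; case XL: (X \in L) => //=; case: eqVneq => [jX|]; rewrite ?andbF // andbT.
by have [_ sXj _] := jL X XL; rewrite (subset_trans sXj) // jX.
Qed.

Definition moebius_from0 L g : Prop :=
  forall Y, Y \in L -> \sum_(X in L | X \subset Y) g X = (Y == set0)%:R.

(** When joining with A never reaches the top from below, Weisner's theorem leaves
    a single term: the family is contracted by the maps from X to the join of X
    and A and from there to A. *)
Lemma moebius_conic L g A (j : {set E} -> {set E}) : moebius_from0 L g ->
  setT \in L -> A != set0 ->
  (forall X, X \in L -> [/\ j X \in L, X \subset j X & A \subset j X]) ->
  (forall X Y, X \in L -> Y \in L -> X \subset Y -> A \subset Y -> j X \subset Y) ->
  (forall X, X \in L -> j X = setT -> X = setT) -> g setT = 0.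
Proof.
move=> gL TL A0 jL jmin jT.
rewrite -[RHS](Weisner (g := g) jL jmin _ TL (subsetT A)) => [|Y YL sAY].
  rewrite (big_pred1 setT) // => X; apply/andP/eqP => [[XL /eqP/jT->//]|->].
  by split=> //; have [_ + _] := jL _ TL; rewrite subTset.
rewrite gL // (negPf (_ : Y != set0)) //; apply: contraNneq A0 => Y0.
by rewrite Y0 subset0 in sAY.
Qed.

Section RingOfSets.
Variables (L : {set {set E}}) (g : {set E} -> int).
Hypotheses (L0 : set0 \in L) (LU : {in L &, forall X Y, X :|: Y \in L}).
Hypotheses (LI : {in L &, forall X Y, X :&: Y \in L}) (gL : moebius_from0 L g).

Definition ring_atom A : bool :=
  [&& A \in L, A != set0 & [forall X in L, (X \subset A) ==> (X == set0) || (X == A)]].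

(** In a ring of sets the only possible complement of an atom A in T is the
    set difference, so Weisner's theorem has at most two terms. *)
Lemma moebius_ring_atom A T : ring_atom A -> T \in L -> A \subset T ->
  g T = if T :\: A \in L then - g (T :\: A) else 0.
Proof.
case/and3P=> AL A0 /forall_inP atomA TL sAT.
have W : \sum_(X in L | X :|: A == T) g X = 0.
  apply: (@Weisner L g A (fun X => X :|: A)) => // [X XL|X Y _ _ sXY sAY|Y YL sAY].
  - by rewrite LU ?subsetUl ?subsetUr.
  - by rewrite subUset sXY.
  rewrite gL // (negPf (_ : Y != set0)) //; apply: contraNneq A0 => Y0.
  by rewrite Y0 subset0 in sAY.
have DT : T :\: A != T.
  apply: contraNneq A0 => DT; rewrite -subset0; apply/subsetP => e eA.
  by have := subsetP sAT e eA; rewrite -DT inE eA.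
have cases X : (X \in L) && (X :|: A == T) =
    (X == T) || ((T :\: A \in L) && (X == T :\: A)).
  apply/andP/orP => [[XL /eqP XA]|[/eqP->|/andP[DL /eqP->]]].
  - have /implyP/(_ (subsetIr X A))/orP[] := atomA _ (LI XL AL).
      rewrite setI_eq0 => dXA; right.
      by rewrite -XA setDUl setDv setU0 (setDidPl dXA) XL eqxx.
    by move=> /eqP/setIidPr sAX; left; rewrite -XA (setUidPl sAX).
  - by rewrite TL (setUidPl sAT).
  by rewrite DL setUC setDE setUIr setUCr setIT (setUidPr sAT).
rewrite (eq_bigl _ _ cases) in W; case: ifP W => DL /= W; last first.
  by rewrite (big_pred1 T) in W => // X; rewrite orbF.
rewrite (bigD1 T) ?eqxx //= (big_pred1 (T :\: A)) in W.
  by apply/eqP; rewrite -subr_eq0 opprK W.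
by move=> X; case: (eqVneq X T) => [->|_] /=; rewrite ?andbF ?andbT // eq_sym (negPf DT).
Qed.

Lemma ex_ring_atom T : T \in L -> T != set0 -> exists2 A, ring_atom A & A \subset T.
Proof.
move=> TL T0; pose p (X : {set E}) := (X \in L) && (X != set0).
have [|A /minsetP[/andP[AL A0] minA] sAT] := @minset_exists _ p T; first by rewrite /p TL.
exists A => //; apply/and3P; split=> //; apply/forall_inP => X XL; apply/implyP => sXA.
by have [//|X0] := eqVneq X set0; rewrite (minA X) ?eqxx // /p XL.
Qed.

(** As long as the Moebius number is nonzero, splitting off an atom of T leaves a
    member of L, and so T is the disjoint union of its atoms. *)
Lemma moebius_ring_complemented T : T \in L -> g T != 0 ->
  forall B, B \in L -> B \subset T -> T :\: B \in L.
Proof.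
have [n] := ubnP #|T|; elim: n T => // n IHn T ltn TL gT B BL sBT.
have [T0|T0] := eqVneq T set0; first by rewrite T0 set0D.
have [A atomA sAT] := ex_ring_atom TL T0; have := atomA; case/and3P=> AL A0 /forall_inP minA.
move: gT; rewrite (moebius_ring_atom atomA TL sAT); case: ifP; last by rewrite eqxx.
rewrite oppr_eq0 => DL gD.
have ltD : (#|T :\: A| < #|T|)%N.
  by rewrite cardsD (setIidPr sAT) ltn_subrL !card_gt0 A0.
have BDL : (T :\: A) :\: (B :&: (T :\: A)) \in L.
  by apply: IHn => //; [exact: leq_trans ltD ltn | exact: LI | exact: subsetIr].
have /implyP/(_ (subsetIr B A))/orP[BA0|/eqP BA] := minA _ (LI BL AL).
  have -> : T :\: B = ((T :\: A) :\: (B :&: (T :\: A))) :|: A.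
    apply/setP => e; have /setP/(_ e) := eqP BA0; have := subsetP sAT e.
    by rewrite !inE; case: (e \in A); case: (e \in T); case: (e \in B) => //= /(_ isT).
  exact: LU.
have -> // : T :\: B = (T :\: A) :\: (B :&: (T :\: A)).
apply/setP => e; have /setP/(_ e) := BA; rewrite !inE.
by case: (e \in A); case: (e \in T); case: (e \in B).
Qed.

End RingOfSets.
End SetFamilies.

(** * Chains of cyclic flats *)

Section FlatChains.
Variables (E : finType) (M : matroid E).
Implicit Types (A X Y F : {set E}) (V : {set {set E}}).

Let Z := cyclic_flats M.

(** Made reflexive on all sets so as to be an order on the whole type. *)
Definition flat_le : rel {set E} :=
  fun X Y => (X == Y) || [&& X \in Z, Y \in Z & X \subset Y].

Lemma flat_le_refl : reflexive flat_le.
Proof. by move=> X; rewrite /flat_le eqxx. Qed.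

Lemma flat_le_anti : antisymmetric flat_le.
Proof.
move=> X Y /andP[/orP[/eqP//|/and3P[_ _ sXY]] /orP[/eqP//|/and3P[_ _ sYX]]].
by apply/eqP; rewrite eqEsubset sXY.
Qed.

Lemma flat_le_trans : transitive flat_le.
Proof.
move=> Y X W /orP[/eqP->//|/and3P[XZ YZ sXY]] /orP[/eqP<-|/and3P[_ WZ sYW]].
  by rewrite /flat_le XZ YZ sXY orbT.
by rewrite /flat_le XZ WZ (subset_trans sXY) ?orbT.
Qed.

Definition flat_moebius := moebius flat_le.

Definition flat_weight X Y : int := (X == Y)%:R - flat_moebius X Y.

Lemma flat_moebius_suml X Y : X \in Z ->
  \sum_(K in Z | X \subset K) flat_moebius K Y = (X == Y)%:R.
Proof.
move=> XZ; rewrite -(moebius_suml flat_le_refl flat_le_anti flat_le_trans).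
apply: eq_bigl => K; rewrite /flat_le XZ /=.
by case: eqVneq => //= <-; rewrite XZ subxx.
Qed.

Lemma flat_moebius_sumr X Y : Y \in Z ->
  \sum_(K in Z | K \subset Y) flat_moebius X K = (X == Y)%:R.
Proof.
move=> YZ; rewrite -(moebius_sumr flat_le_refl flat_le_anti flat_le_trans).
apply: eq_bigl => K; rewrite /flat_le YZ /=.
by case: eqVneq => //= ->; rewrite YZ subxx.
Qed.

Lemma flat_weight_neq0 X Y : flat_weight X Y != 0 -> X \proper Y.
Proof.
rewrite /flat_weight; case: (eqVneq X Y) => [->|nXY].
  by rewrite /flat_moebius (moebius_diag flat_le_refl flat_le_anti flat_le_trans) subrr eqxx.
rewrite sub0r oppr_eq0 => h; rewrite properEneq nXY /=; apply: contraNT h => nsXY.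
rewrite /flat_moebius (moebius_triangular flat_le_refl flat_le_anti flat_le_trans) //.
by rewrite /flat_le (negPf nXY) (negPf nsXY) !andbF.
Qed.

Lemma weight_neq0_proper k (F : {ffun 'I_k.+1 -> {set E}}) :
  weight flat_weight F != 0 -> forall i j : 'I_k.+1, (i < j)%N -> F i \proper F j.
Proof.
move=> wF; have step i : F (widen_ord (leqnSn k) i) \proper F (lift ord0 i).
  apply: flat_weight_neq0; apply: contra wF => /eqP w0; apply/eqP.
  by rewrite /weight (bigD1 i) //= w0 mul0r.
have mono := chain_monotone (fun i => proper_sub (step i)).
move=> i j ltij; have ltik : (i < k)%N by have := ltn_ord j; lia.
apply: proper_sub_trans (_ : F (lift ord0 (Ordinal ltik)) \subset _).
  have {1}-> : i = widen_ord (leqnSn k) (Ordinal ltik) by apply: val_inj.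
  exact: step.
by apply: mono; rewrite /= /bump /=.
Qed.

(** One set of candidates for each position of a chain, so that chains of flats
    avoiding V and chains of flats through given blocks are sums of the same
    form. *)
Definition avoiding V (i : nat) : {set {set E}} := if i is 0 then [set set0] else Z :\: V.

Lemma chain_in_avoiding V k (F : {ffun 'I_k.+1 -> {set E}}) : set0 \notin V ->
  chain_in (avoiding V) F = chain_in (avoiding set0) F && [forall i, F i \notin V].
Proof.
move=> V0; apply/forallP/andP => [FV|[/forallP F0 /forallP FV] i].
  split; apply/forallP => i; have := FV i; case: (nat_of_ord i) => [|m] /=.
  - by [].
  - by rewrite !inE => /andP[_ ->].
  - by rewrite inE => /eqP->.
  by rewrite !inE => /andP[].
have := F0 i; have := FV i; case: (nat_of_ord i) => [|m] //=.
by rewrite !inE => -> /=.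
Qed.

Hypotheses (Z0 : set0 \in Z) (ZT : setT \in Z).

Section Avoiding.
Variables (V : {set {set E}}) (n : nat).
Hypotheses (sVZ : V \subset Z) (V0 : set0 \notin V) (VT : setT \notin V).
Hypothesis vanish : forall Y, chain_sum flat_weight (avoiding V) n Y = 0.

Definition avoiding_sum Y : int := \sum_(k < n) chain_sum flat_weight (avoiding V) k Y.

Let h := avoiding_sum.
Let g Y := \sum_X h X * flat_moebius X Y.

Let h_rec Y : Y \in Z :\: V -> h Y = (Y == set0)%:R + \sum_X h X * flat_weight X Y.
Proof.
move=> YZV; have -> : h Y = \sum_(k < n.+1) chain_sum flat_weight (avoiding V) k Y.
  by rewrite big_ord_recr /= vanish addr0.
rewrite big_ord_recl chain_sum0 inE; congr (_ + _).
under [RHS]eq_bigr do rewrite mulr_suml.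
rewrite exchange_big /=; apply: eq_bigr => k _; exact: chain_sumS.
Qed.

Let h_V Y : Y \in V -> h Y = 0.
Proof.
move=> YV; rewrite /h /avoiding_sum big1 // => -[[|k] ltk] _; apply: chain_sum_notin => /=.
  by rewrite inE; apply: contraNneq V0 => <-.
by rewrite inE YV.
Qed.

Let g_notV Y : Y \in Z :\: V -> g Y = (Y == set0)%:R.
Proof.
move=> YZV; have := h_rec YZV; rewrite /flat_weight.
have -> : \sum_X h X * ((X == Y)%:R - flat_moebius X Y) = h Y - g Y.
  under eq_bigr do rewrite mulrBr.
  rewrite sumrB; congr (_ - _); rewrite (bigD1 Y) //= eqxx mulr1 big1 ?addr0 // => X /negPf->.
  by rewrite mulr0.
by rewrite addrCA -{1}[h Y]addr0 => /addrI/esym/eqP; rewrite subr_eq0 => /eqP.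
Qed.

Let g_sum Y : Y \in Z -> \sum_(X in Z | X \subset Y) g X = h Y.
Proof.
move=> YZ; rewrite exchange_big /=.
under eq_bigr do rewrite -mulr_sumr flat_moebius_sumr //.
rewrite (bigD1 Y) //= eqxx mulr1 big1 ?addr0 // => X /negPf->.
by rewrite mulr0.
Qed.

Lemma avoiding_sum_empty : V = set0 -> avoiding_sum setT = 1.
Proof.
move=> Vn; rewrite -/(h _) -g_sum // (bigD1 set0) ?Z0 ?sub0set //= g_notV ?Vn ?setD0 // eqxx.
by rewrite big1 ?addr0 // => X /andP[/andP[XZ _] /negPf X0]; rewrite g_notV ?X0 // Vn setD0.
Qed.

(** Multiplying the generating function of the chains avoiding V by the Moebius
    function gives a function supported on V and the empty set, whose partial
    sums vanish on V: up to the value at the top it is the Moebius function of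
    V with a bottom and a top added. *)
Lemma avoiding_sum_moebius : (setT != set0 :> {set E}) ->
  exists2 g, moebius_from0 (set0 |: (setT |: V)) g & avoiding_sum setT = - g setT.
Proof.
move=> E0; pose g1 X := if X == setT then - h setT else g X.
exists g1; last by rewrite /g1 eqxx opprK.
have onL X : X != setT -> (if X \in set0 |: (setT |: V) then g1 X else 0) =
    (if X \in Z then g X else 0).
  move=> XT; rewrite /g1 (negPf XT) !in_setU1 (negPf XT) /=.
  have [->|X0] /= := eqVneq X set0; first by rewrite Z0.
  have [XV|XV] := boolP (X \in V); first by rewrite (subsetP sVZ).
  by case: ifP => // XZ; rewrite g_notV ?(negPf X0) // in_setD XV.
have gT : g setT = 0 by rewrite g_notV ?(negPf E0) // in_setD VT.
move=> Y YL; have YZ : Y \in Z.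
  by move: YL; rewrite !in_setU1 => /or3P[/eqP->|/eqP->|/(subsetP sVZ)].
have hY : Y != setT -> h Y = (Y == set0)%:R.
  move=> YT; move: YL; rewrite !in_setU1 (negPf YT) /= => /orP[/eqP->|YV].
    rewrite -g_sum // (big_pred1 set0) => [|X]; first by rewrite g_notV ?eqxx // in_setD V0.
    by rewrite subset0 andb_idl // => /eqP->.
  by rewrite h_V //; case: eqVneq YV V0 => // -> ->.
have [->|YT] := eqVneq Y setT.
  rewrite (negPf E0) (bigD1 setT) ?in_setU1 ?eqxx ?orbT //= {1}/g1 eqxx -[X in - X]g_sum //.
  rewrite [X in - X](bigD1 setT) ?ZT ?subxx //= gT add0r.
  rewrite [X in _ + X](_ : _ = \sum_(X in Z | (X \subset setT) && (X != setT)) g X).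
    by under [X in - X]eq_bigl do rewrite -andbA; rewrite addNr.
  rewrite big_mkcond [RHS]big_mkcond; apply: eq_bigr => X _; rewrite subsetT /= andbT.
  have [->|XT] := eqVneq X setT; first by rewrite !andbF.
  by rewrite !andbT onL.
rewrite -hY // -g_sum // big_mkcondr [RHS]big_mkcondr big_mkcond [RHS]big_mkcond.
apply: eq_bigr => X _; have [->|XT] := eqVneq X setT.
  by rewrite subTset (negPf YT) !if_same.
by case: (X \subset Y); rewrite ?if_same // onL.
Qed.

End Avoiding.
End FlatChains.

(** * Connected components *)

Section Components.
Variables (E : finType) (M : matroid E).
Implicit Types (A T X : {set E}).

Let e := same_circuit M.

Lemma same_circuit_connect_sym : connect_sym e.
Proof.
apply: sym_connect_sym => x y; apply/existsP/existsP => -[C /and3P[circC xC yC]];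
  by exists C; rewrite circC xC yC.
Qed.

Lemma closed_setP A : reflect (fingraph.closed e (mem A)) (separator M A).
Proof. by apply: (iffP idP); [exact: separator_closed | exact: closed_separator]. Qed.

Lemma separator0 : separator M set0.
Proof. by rewrite /separator rk0 setC0. Qed.

Lemma separatorT : separator M setT.
Proof. by rewrite /separator setCT rk0 addn0. Qed.

(** The separators form a Boolean algebra whose atoms are the connected
    components. *)
Lemma moebius_separators (g : {set E} -> int) :
  moebius_from0 [set A | separator M A] g -> g setT = (-1) ^+ n_components M.
Proof.
move=> gL; set L := [set A | _] in gL.
have inL A : (A \in L) = separator M A by rewrite inE.
have LU : {in L &, forall X Y, X :|: Y \in L}.
  move=> X Y; rewrite !inL => /closed_setP cX /closed_setP cY; apply/closed_setP => x y exy.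
  by rewrite !inE; congr (_ || _); [exact: cX | exact: cY].
have LI : {in L &, forall X Y, X :&: Y \in L}.
  move=> X Y; rewrite !inL => /closed_setP cX /closed_setP cY; apply/closed_setP => x y exy.
  by rewrite !inE; congr (_ && _); [exact: cX | exact: cY].
suff main T : T \in L -> g T = (-1) ^+ n_comp e T.
  by rewrite main ?inL ?separatorT //; congr (_ ^+ _); apply: eq_n_comp_r => x; rewrite inE.
have [n] := ubnP #|T|; elim: n T => // n IHn T ltn TL.
have [T0|/set0Pn[t tT]] := eqVneq T set0.
  have := gL T TL; rewrite T0 eqxx (big_pred1 set0) => [->|X].
    by rewrite /n_comp_mem eq_card0 // => x; rewrite !inE andbF.
  by rewrite subset0 andb_idl // => /eqP->; rewrite inL separator0.
have clT : fingraph.closed e (mem T) by apply/closed_setP; rewrite -inL.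
pose A := [set y | connect e t y].
have AL : A \in L.
  rewrite inL; apply/closed_setP => x y exy; rewrite !inE.
  by rewrite (same_connect_r same_circuit_connect_sym (connect1 exy)).
have sAT : A \subset T.
  by apply/subsetP => y; rewrite inE => /(closed_connect clT) <-.
have tA : t \in A by rewrite inE connect0.
have atomA : ring_atom L A.
  apply/and3P; split=> //; first by apply/set0Pn; exists t.
  apply/forall_inP => X XL; apply/implyP => sXA.
  have clX : fingraph.closed e (mem X) by apply/closed_setP; rewrite -inL.
  have [->//|/set0Pn[x xX]] := eqVneq X set0.
  rewrite eqEsubset sXA /=; apply/subsetP => y; rewrite inE => ty.
  have := subsetP sXA x xX; rewrite inE same_circuit_connect_sym => xt.
  by rewrite -(closed_connect clX (connect_trans xt ty)).
have DL : T :\: A \in L.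
  rewrite inL; apply/closed_setP => x y exy; rewrite !inE.
  have clA : fingraph.closed e (mem A) by apply/closed_setP; rewrite -inL.
  by have := clA x y exy; rewrite !inE => ->; congr (_ && _); apply: clT.
have L0 : set0 \in L by rewrite inL separator0.
rewrite (moebius_ring_atom LU LI gL atomA TL sAT) DL IHn //; last first.
  rewrite -ltnS; apply: leq_trans ltn; rewrite ltnS cardsD (setIidPr sAT) ltn_subrL.
  by rewrite !card_gt0; apply/andP; split; apply/set0Pn; exists t.
suff -> : n_comp e T = (n_comp e (T :\: A)).+1 by rewrite exprS mulN1r.
rewrite /n_comp_mem -(cardID (mem A)) -add1n; congr (_ + _)%N.
  rewrite -(n_comp_connect same_circuit_connect_sym t); apply: eq_card => x.
  rewrite !inE -andbA; case: (boolP (connect e t x)) => [tx|_]; last by rewrite !andbF.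
  by rewrite -(closed_connect clT tx) tT andbT.
by apply: eq_card => x; rewrite !inE; case: (x \in T); rewrite ?andbF ?andbT // andbC.
Qed.

End Components.

(** * The chains of cyclic flats seen from a point *)

Section Evaluation.
Variables (R : realType) (E : finType) (M : matroid E).
Hypotheses (lM : loopless M) (clM : coloopless M).
Implicit Types (A X Y F : {set E}).
Variables (x : 'rV[R]_#|E|) (n : nat).

Hypothesis xT : mass x setT = (rk M setT)%:R.

Let excess0 : excess M x set0 = 0.
Proof. by rewrite /excess mass0 rk0 subrr. Qed.

Let excessT : excess M x setT = 0.
Proof. by rewrite /excess xT subrr. Qed.

Definition violated : {set {set E}} :=
  [set F in cyclic_flats M | 0 < excess M x F].

Definition saturated : {set {set E}} :=
  [set F in cyclic_flats M | [&& F != set0, F != setT & 0 <= excess M x F]].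

Lemma in_violated F : (F \in violated) = (F \in cyclic_flats M) && (0 < excess M x F).
Proof. by rewrite in_set. Qed.

Lemma in_saturated F : (F \in saturated) =
  (F \in cyclic_flats M) && [&& F != set0, F != setT & 0 <= excess M x F].
Proof. by rewrite in_set. Qed.

Lemma ex_max_excess : exists A, forall B, excess M x B <= excess M x A.
Proof.
by case: (@arg_maxP _ _ _ set0 predT (excess M x) isT) => A _ maxA; exists A => B; apply: maxA.
Qed.

Lemma closure_id A : A \in cyclic_flats M -> rk_closure M A = A.
Proof.
by move=> AZ; apply/eqP; rewrite eqEsubset sub_closure closure_sub_flat.
Qed.

Let Z0 := set0_cyclic_flat lM.
Let ZT := setT_cyclic_flat clM.

Section Join.
Variable A : {set E}.
Hypothesis maxA : forall B, excess M x B <= excess M x A.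

(** The intersection of X with A cannot exceed A, so by supermodularity the union
    does not lose excess against X. *)
Lemma excess_join X : (forall e, 0 <= entry x e) ->
  excess M x X <= excess M x (rk_closure M (X :|: A)).
Proof.
move=> x0; have := excess_supermodular M x X A; have := maxA (X :&: A).
suff : excess M x (X :|: A) <= excess M x (rk_closure M (X :|: A)) by lra.
by rewrite /excess rk_closureE lerD2r massS ?sub_closure.
Qed.

End Join.

(** The violated flats form a family with a Moebius number of zero, because it
    can be contracted by joining with a flat of largest excess. *)
Lemma avoiding_violated : (forall e, 0 <= entry x e <= 1) ->
  (forall Y, chain_sum (flat_weight M) (avoiding M violated) n Y = 0) ->
  avoiding_sum M violated n setT = (violated == set0)%:R.
Proof.
move=> x01 vanish; have x0 e : 0 <= entry x e by have /andP[] := x01 e.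
have sV : violated \subset cyclic_flats M.
  by apply/subsetP => F; rewrite in_violated => /andP[].
have V0 : set0 \notin violated by rewrite in_violated excess0 ltxx andbF.
have VT : setT \notin violated by rewrite in_violated excessT ltxx andbF.
have [Ve|/set0Pn[F0 F0V]] := eqVneq violated set0.
  exact: avoiding_sum_empty.
have E0 : setT != set0 :> {set E}.
  apply: contraNneq V0 => T0; suff <- : F0 = set0 by [].
  by apply/eqP; rewrite -subset0 -T0 subsetT.
have [g gL ->] := avoiding_sum_moebius Z0 ZT sV V0 VT vanish E0.
have [A1 maxA1] := ex_max_excess; have [A AZ leA] := excess_cyclic_flat M A1 x01.
have maxA B : excess M x B <= excess M x A by apply: le_trans (maxA1 B) leA.
have excA : 0 < excess M x A.
  by apply: lt_le_trans (maxA F0); move: F0V; rewrite in_violated => /andP[].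
set L := set0 |: _ in gL.
have LZ X : X \in L -> X \in cyclic_flats M.
  by rewrite !in_setU1 => /or3P[/eqP->|/eqP->|/(subsetP sV)].
have joinV X : X \in set0 |: violated -> rk_closure M (X :|: A) \in violated.
  rewrite in_setU1 => /predU1P[->|XV].
    by rewrite set0U closure_id // in_violated AZ.
  move: XV; rewrite !in_violated => /andP[XZ excX]; rewrite join_cyclic_flat //=.
  exact: lt_le_trans excX (excess_join maxA _ _).
apply/eqP; rewrite oppr_eq0; apply/eqP.
apply: (moebius_conic (A := A) (j := fun X => rk_closure M (X :|: A)) gL).
- by rewrite /L !in_setU1 eqxx orbT.
- by apply: contraTneq excA => ->; rewrite excess0 ltxx.
- move=> X XL; split; try exact: subset_trans (sub_closure _ _); last first.
  + exact: subset_trans (subsetUr X A) (sub_closure _ _).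
  + exact: subset_trans (subsetUl X A) (sub_closure _ _).
  have [->|XT] := eqVneq X setT; first by rewrite setTU closure_id // /L !in_setU1 eqxx orbT.
  rewrite /L 2!in_setU1 joinV ?orbT //.
  by move: XL; rewrite /L !in_setU1 (negPf XT).
- by move=> X Y _ /LZ YZ sXY sAY; rewrite closure_sub_flat // subUset sXY.
move=> X XL jT; apply: contraNeq VT => XT; rewrite -jT joinV //.
by move: XL; rewrite /L !in_setU1 (negPf XT).
Qed.

(** Given x(E) = rk E and entries strictly between 0 and 1, this says that x is in
    the relative interior of P(M). *)
Definition relint_condition : bool :=
  [forall A, (mass x A <= (rk M A)%:R) && ((mass x A == (rk M A)%:R) ==> separator M A)].

(** In the open cube, adding an element of the closure or removing a coloop would
    strictly increase the excess. *)
Lemma max_excess_cyclic_flat A : (forall e, 0 < entry x e < 1) ->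
  (forall B, excess M x B <= excess M x A) -> A \in cyclic_flats M.
Proof.
move=> x01 maxA; apply/cyclic_flatP; split=> e eA.
  have /andP[xe _] := x01 e; have := maxA (e |: A); rewrite /excess massU1 //.
  by move=> h; rewrite -(ltr_nat R); lra.
have /andP[_ xe] := x01 e; have := maxA (A :\ e); rewrite /excess (massD1 x eA) => h.
apply/eqP; rewrite eqn_leq rkS ?subsetDl //= leqNgt; apply/negP.
by rewrite -(ler_nat R) -natr1; lra.
Qed.

Lemma saturated_moebius_family :
  set0 |: (setT |: saturated) = [set F in cyclic_flats M | 0 <= excess M x F].
Proof.
apply/setP => F; rewrite !in_setU1 in_saturated [RHS]in_set.
have [->|F0] := eqVneq F set0; first by rewrite excess0 lexx andbT Z0.
by have [->|FT] := eqVneq F setT; first by rewrite excessT lexx andbT ZT.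
Qed.

(** If some set has positive excess, join with the least set of largest excess;
    otherwise the tight sets form a ring of sets whose Moebius number is nonzero
    only if they are all separators. *)
Lemma avoiding_saturated : (forall e, 0 < entry x e < 1) ->
  (forall Y, chain_sum (flat_weight M) (avoiding M saturated) n Y = 0) ->
  avoiding_sum M saturated n setT = (-1) ^+ (n_components M).-1 * relint_condition%:R.
Proof.
move=> x01 vanish; have x0 e : 0 <= entry x e by have /andP[/ltW] := x01 e.
have sV : saturated \subset cyclic_flats M.
  by apply/subsetP => F; rewrite in_saturated => /andP[].
have V0 : set0 \notin saturated by rewrite in_saturated eqxx andbF.
have VT : setT \notin saturated by rewrite in_saturated eqxx !andbF.
(* On the empty ground set there is one chain, with a single member. *)
have [E0|E0] := eqVneq (setT : {set E}) set0.
  have all0 X : X = setT by apply/eqP; rewrite eqEsubset subsetT E0 sub0set.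
  rewrite avoiding_sum_empty //; last first.
    by apply/setP => X; rewrite (all0 X) (negPf VT) inE.
  have -> : relint_condition.
    by apply/forallP => A; rewrite (all0 A) xT lexx eqxx separatorT.
  have -> : n_components M = 0%N; last by rewrite expr0 mulr1.
  rewrite /n_components /n_comp_mem eq_card0 // => e.
  by have := in_setT e; rewrite E0 inE.
have [g gL ->] := avoiding_sum_moebius Z0 ZT sV V0 VT vanish E0.
rewrite saturated_moebius_family in gL; set L := [set F in _ | _] in gL.
have inL F : (F \in L) = (F \in cyclic_flats M) && (0 <= excess M x F) by rewrite in_set.
have LT : setT \in L by rewrite inL ZT excessT lexx.
have [A1 maxA1] := ex_max_excess.
have [le0|gt0] := leP (excess M x A1) 0; last first.
  have -> : relint_condition = false.
    by apply/negbTE/forallPn; exists A1; rewrite negb_and -ltNge -subr_gt0 gt0.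
  have [A [/forallP maxA minA]] :
      exists A : {set E}, [forall B : {set E}, excess M x B <= excess M x A] /\
      forall A' : {set E}, [forall B : {set E}, excess M x B <= excess M x A'] -> (#|A| <= #|A'|)%N.
    pose p A := [forall B : {set E}, excess M x B <= excess M x A].
    have max1 : p A1 by apply/forallP.
    by case: (arg_minnP (fun A : {set E} => #|A|) max1) => A maxA minA; exists A.
  have AZ := max_excess_cyclic_flat x01 maxA.
  have excA := lt_le_trans gt0 (maxA A1).
  rewrite mulr0; apply/eqP; rewrite oppr_eq0; apply/eqP.
  apply: (moebius_conic (A := A) (j := fun X => rk_closure M (X :|: A)) gL) => //.
  - by apply: contraTneq excA => ->; rewrite excess0 ltxx.
  - move=> X; rewrite !inL => /andP[XZ X0]; split.
    + by rewrite join_cyclic_flat //= (le_trans X0) // excess_join.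
    + exact: subset_trans (subsetUl X A) (sub_closure _ _).
    exact: subset_trans (subsetUr X A) (sub_closure _ _).
  - by move=> X Y _; rewrite inL => /andP[YZ _] sXY sAY; rewrite closure_sub_flat // subUset sXY.
  move=> X; rewrite inL => /andP[XZ X0] jT.
  (* The intersection of X and A has largest excess, hence contains A. *)
  have sAX : A \subset X.
    have leU : excess M x (X :|: A) <= 0.
      rewrite -excessT -jT /excess rk_closureE lerD2r massS //; exact: sub_closure.
    have := excess_supermodular M x X A => sup.
    have leA : (#|A| <= #|X :&: A|)%N.
      by apply: minA; apply/forallP => B; have := maxA B; lra.
    by apply/setIidPr/eqP; rewrite eqEcard subsetIr.
  by rewrite -(closure_id XZ) -{1}(setUidPl sAX).
have excle B : excess M x B <= 0 := le_trans (maxA1 B) le0.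
have inL0 F : (F \in L) = (excess M x F == 0).
  rewrite inL [RHS]eq_le excle /=; case: (boolP (0 <= _)) => h; rewrite ?andbF // andbT.
  by apply: max_excess_cyclic_flat => // B; apply: le_trans (excle B) h.
have tightUI X Y : X \in L -> Y \in L -> (X :|: Y \in L) && (X :&: Y \in L).
  rewrite !inL0 => /eqP eX /eqP eY; have := excess_supermodular M x X Y.
  have := excle (X :|: Y); have := excle (X :&: Y); rewrite eX eY !eq_le.
  by move=> -> ->; rewrite /= => h1; apply/andP; split; have := excle (X :|: Y);
     have := excle (X :&: Y); lra.
have LU : {in L &, forall X Y, X :|: Y \in L} by move=> X Y XL YL; have /andP[] := tightUI X Y XL YL.
have LI : {in L &, forall X Y, X :&: Y \in L} by move=> X Y XL YL; have /andP[] := tightUI X Y XL YL.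
have L0 : set0 \in L by rewrite inL0 excess0.
have tight_compl A : (A \in L) && (~: A \in L) = separator M A.
  have mT : mass x A + mass x (~: A) = (rk M setT)%:R.
    by rewrite -xT (massID x setT A) setTI setTD.
  have := excle A; have := excle (~: A); rewrite !inL0 /excess => leAC leA.
  apply/andP/eqP => [[/eqP tA /eqP tAC]|sA].
    by apply/eqP; rewrite -(eqr_nat R) natrD; apply/eqP; lra.
  have : (rk M A)%:R + (rk M (~: A))%:R = (rk M setT)%:R :> R by rewrite -natrD sA.
  by move=> sA'; split; apply/eqP; lra.
have tightE A : (mass x A == (rk M A)%:R) = (A \in L) by rewrite inL0 subr_eq0.
have [cond|] := boolP relint_condition.
  have sepL : L = [set A | separator M A].
    apply/setP => A; rewrite [RHS]in_set -tight_compl; case AL: (A \in L) => //=; apply/esym.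
    by have /forallP/(_ A) := cond; rewrite tightE AL /= => /andP[_]; rewrite -tight_compl AL.
  rewrite sepL in gL; rewrite (moebius_separators gL) mulr1.
  have : (0 < n_components M)%N.
    have /set0Pn[e _] := E0; apply/card_gt0P; exists (fingraph.root (same_circuit M) e).
    by rewrite !inE andbT roots_root //; apply: same_circuit_connect_sym.
  by case: (n_components M) => //= m _; rewrite exprS mulN1r opprK.
move=> /forallPn[A]; rewrite tightE negb_and -ltNge -subr_gt0 ltNge excle /=.
rewrite negb_imply -tight_compl => /andP[AL]; rewrite AL /= => nAC.
rewrite mulr0; apply/eqP; rewrite oppr_eq0; apply: contraNT nAC => gT.
by rewrite -setTD (moebius_ring_complemented L0 LU LI gL LT gT).
Qed.

End Evaluation.

(** * From flats to blocks *)

Section Blocks.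
Variables (E : finType) (M : matroid E) (P : {set {set {set E}}}).
Hypotheses (lM : loopless M) (clM : coloopless M) (condP : condensation M P).
Implicit Types (X Y : {set E}) (i j : 'I_#|P|).

Let Z := cyclic_flats M.
Let Z0 : set0 \in Z := set0_cyclic_flat lM.
Let ZT : setT \in Z := setT_cyclic_flat clM.

Let coverP : cover P = Z.
Proof. by have [/and3P[/eqP]] := condP. Qed.

Let trivP : trivIset P.
Proof. by have [/and3P[]] := condP. Qed.

Definition block i : {set {set E}} := enum_val i.

Lemma block_in i : block i \in P.
Proof. exact: enum_valP. Qed.

Lemma block_flatP i : block_flat (block i) \in block i.
Proof.
rewrite /block_flat; case: pickP => //= none.
have [/and3P[_ _ /negP[]]] := condP.
by rewrite (_ : set0 = block i) ?block_in //; apply/setP => X; rewrite inE none.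
Qed.

Lemma block_sub i X : X \in block i -> X \in Z.
Proof. by move=> Xi; rewrite -coverP; apply/bigcupP; exists (block i); rewrite ?block_in. Qed.

Lemma block_uniform i X Y : X \in block i -> Y \in block i -> rk M X = rk M Y /\ #|X| = #|Y|.
Proof. by have [_ unif _] := condP; apply: unif; apply: block_in. Qed.

Lemma block_cardE i X : X \in block i -> block_card (block i) = #|X|.
Proof. by move=> Xi; rewrite /block_card; have [_ ->] := block_uniform (block_flatP i) Xi. Qed.

Lemma block_rkE i X : X \in block i -> block_rk M (block i) = rk M X.
Proof. by move=> Xi; rewrite /block_rk; have [-> _] := block_uniform (block_flatP i) Xi. Qed.

Lemma incidenceE i j Y : Y \in block j ->
  incidence (block i) (block j) = #|[set X in block i | X \subset Y]|.
Proof.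
by move=> Yj; have [_ _ cnt] := condP; apply: cnt (block_in _) (block_in _) _ _ (block_flatP j) Yj.
Qed.

Let pblock0 : pblock P set0 \in P.
Proof. by rewrite pblock_mem // coverP. Qed.

Definition block_index X : 'I_#|P| := enum_rank_in pblock0 (pblock P X).

Lemma block_indexP X i : X \in Z -> (block_index X == i) = (X \in block i).
Proof.
move=> XZ; have pX : pblock P X \in P by rewrite pblock_mem // coverP.
apply/eqP/idP => [<-|Xi].
  by rewrite /block /block_index enum_rankK_in // mem_pblock coverP.
by rewrite /block_index (def_pblock trivP (block_in i) Xi) /block enum_valK_in.
Qed.

Lemma sum_blocks (G : nmodType) (f : {set E} -> G) :
  \sum_(X in Z) f X = \sum_i \sum_(X in block i) f X.
Proof. by rewrite -coverP big_trivIset // big_enum_val. Qed.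

Let inc := incidence_mx P.

(** The entry (i, l) of the incidence matrix is the number of flats of block i
    below any flat X of block l, so the left side is the Moebius function
    convolved with the zeta function and summed over block i. *)
Lemma incidence_moebius i j Y : Y \in block j ->
  \sum_l inc i l * \sum_(X in block l) flat_moebius M X Y = (i == j)%:R.
Proof.
move=> Yj; transitivity (\sum_(X in Z) \sum_(K in block i | K \subset X) flat_moebius M X Y).
  rewrite sum_blocks; apply: eq_bigr => l _; rewrite mulr_sumr; apply: eq_bigr => X Xl.
  rewrite sumr_const mxE (incidenceE i Xl) -mulr_natl natz; congr (_%:Z * _).
  by apply: eq_card => K; rewrite inE.
rewrite (exchange_big_dep (mem (block i))) /= => [|X K _ /andP[]//].
rewrite (eq_bigr (fun K => (K == Y)%:R)) => [|K Ki]; last first.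
  rewrite -(flat_moebius_suml _ (block_sub Ki)); apply: eq_bigl => X.
  by rewrite Ki.
have YZ := block_sub Yj; have <- : block_index Y = j by apply/eqP; rewrite block_indexP.
rewrite eq_sym block_indexP //; case: (boolP (Y \in block i)) => Yi.
  by rewrite (bigD1 Y) //= eqxx big1 ?addr0 // => K /andP[_ /negPf->].
by rewrite big1 // => K Ki; case: eqVneq => // KY; rewrite -KY Ki in Yi.
Qed.

(** The block sums for one flat Y in each block form a right inverse of the
    incidence matrix; once it is known to be invertible, they do not depend on the
    choice of Y. *)
Lemma block_moebius_sum i j Y : Y \in block j ->
  \sum_(X in block i) flat_moebius M X Y = invmx inc i j.
Proof.
move=> Yj; have unitA : inc \in unitmx.
  pose U : 'M[int]_#|P| := \matrix_(l, m) \sum_(X in block l) flat_moebius M X (block_flat (block m)).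
  have : inc *m U = 1%:M.
    apply/matrixP => l m; rewrite !mxE -(incidence_moebius l (block_flatP m)).
    by apply: eq_bigr => q _; rewrite [U _ _]mxE.
  by case/mulmx1_unit.
pose u : 'cV[int]_#|P| := \col_l \sum_(X in block l) flat_moebius M X Y.
have Au : inc *m u = delta_mx j 0.
  apply/colP => l; rewrite !mxE eqxx andbT -(incidence_moebius l Yj).
  by apply: eq_bigr => q _; rewrite [u _ _]mxE.
have : u i 0 = (invmx inc *m (delta_mx j 0 : 'cV_#|P|)) i 0 by rewrite -Au mulKmx.
by rewrite -colE !mxE.
Qed.

Lemma block_weight_sum i j Y : i != j -> Y \in block j ->
  \sum_(X in block i) flat_weight M X Y = - invmx inc i j.
Proof.
move=> nij Yj; rewrite sumrB (block_moebius_sum i Yj) big1 ?sub0r // => X Xi.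
case: eqVneq => // XY; case/negP: nij; rewrite -XY in Yj.
have <- : block_index X = i by apply/eqP; rewrite block_indexP // (block_sub Xi).
by rewrite block_indexP // (block_sub Xi).
Qed.

Section BlockChain.
Variables (k : nat) (B : {ffun 'I_k.+1 -> 'I_#|P|}).

Definition blocks_of (m : nat) : {set {set E}} := block (B (inord m)).

Lemma chain_in_blocks (F : {ffun 'I_k.+1 -> {set E}}) :
  chain_in blocks_of F = [forall m, F m \in block (B m)].
Proof. by apply: eq_forallb => m; rewrite /blocks_of inord_val. Qed.

Lemma block_chain_neq : block_chain B -> forall m : 'I_k,
  B (widen_ord (leqnSn k) m) != B (lift ord0 m).
Proof.
case/and3P=> _ _ /forallP lt m; have /andP[+ _] := lt m.
by apply: contraNneq => ->.
Qed.

Lemma chain_sum_weight : block_chain B ->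
  chain_sum (flat_weight M) blocks_of k setT = chain_weight B.
Proof.
move=> chB; have neqB := block_chain_neq chB; case/and3P: chB => _ /eqP BT _.
rewrite (@chain_sum_blocks _ _ _ (fun m => - invmx inc (B (inord m)) (B (inord m.+1)))).
- apply: eq_bigr => m _; congr (- invmx _ (B _) (B _)); apply: val_inj;
    by rewrite /= ?bump0 inordK //; have := ltn_ord m; lia.
- move=> m Y ltm Ym; apply: block_weight_sum => //.
  have := neqB (Ordinal ltm); congr (~~ (B _ == B _)); apply: val_inj;
    by rewrite /= inordK //; lia.
by rewrite /blocks_of -[k]/(nat_of_ord (@ord_max k)) inord_val /block BT inE.
Qed.

End BlockChain.

Definition Schubert_of k (F : {ffun 'I_k.+1 -> {set E}}) : matroid E :=
  Schubert_matroid M [set F m | m : 'I_k.+1].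

Section FlatChain.
Variables (k : nat) (F : {ffun 'I_k.+1 -> {set E}}).
Hypotheses (Fflats : chain_in (avoiding M set0) F) (FT : F ord_max = setT).
Hypothesis wF : weight (flat_weight M) F != 0.

Let D := [set F m | m : 'I_k.+1].

Lemma flat_chain0 : F ord0 = set0.
Proof. by have /forallP/(_ ord0) := Fflats; rewrite /= inE => /eqP. Qed.

Lemma flat_chain_flat m : F m \in Z.
Proof.
have /forallP/(_ m) := Fflats; case: (nat_of_ord m) => [|l] /=.
  by rewrite inE => /eqP->.
by rewrite in_setD => /andP[].
Qed.

Lemma flat_chain_chain : {in D &, forall X Y, (X \subset Y) || (Y \subset X)}.
Proof.
move=> X Y /imsetP[m _ ->] /imsetP[l _ ->].
case: (ltngtP m l) => [ltml|ltlm|/val_inj->]; last by rewrite subxx.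
- by rewrite (proper_sub (weight_neq0_proper wF ltml)).
by rewrite (proper_sub (weight_neq0_proper wF ltlm)) orbT.
Qed.

Lemma flat_chain_in0 : set0 \in D.
Proof. by rewrite -flat_chain0 imset_f. Qed.

Lemma flat_chain_inT : setT \in D.
Proof. by rewrite -FT imset_f. Qed.

Lemma flat_chain_cyclic : {subset D <= Z}.
Proof. by move=> X /imsetP[m _ ->]; apply: flat_chain_flat. Qed.

Let SchE := cyclic_flats_Schubert flat_chain_chain flat_chain_in0 flat_chain_inT flat_chain_cyclic.
Let SchT := rk_SchubertT M flat_chain_chain flat_chain_in0.

Let rk_Sch m : rk (Schubert_of F) (F m) = rk M (F m).
Proof. by apply: rk_Schubert; [exact: flat_chain_chain | exact: flat_chain_in0 | exact: imset_f]. Qed.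

Lemma is_Schubert_of (s r : 'I_k.+1 -> nat) :
  (forall m, s m = #|F m|) -> (forall m, r m = rk M (F m)) ->
  is_Schubert (Schubert_of F) s r.
Proof.
move=> sF rF; apply/existsP; exists F; rewrite /Schubert_of SchE eqxx /=; apply/andP; split.
  by apply/forallP => m; apply: (weight_neq0_proper wF); rewrite /= /bump.
by apply/forallP => m; rewrite sF rF eqxx rk_Sch /=.
Qed.

Lemma base_polytope_Schubert (R : realType) (x : 'rV[R]_#|E|) :
  base_polytope (Schubert_of F) x <->
  [/\ forall e, 0 <= entry x e <= 1, mass x setT = (rk M setT)%:R
    & [forall m, F m \notin violated M x]].
Proof.
rewrite base_polytopeP rank_polytopeP SchE SchT; split=> -[x01 xT xF]; split=> //.
  apply/forallP => m; rewrite in_violated negb_and flat_chain_flat /= -leNgt subr_le0.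
  by rewrite -rk_Sch xF // imset_f.
move=> Y /imsetP[m _ ->]; rewrite -/(Schubert_of F) rk_Sch -subr_le0 leNgt; apply/negP => exc.
by have /forallP/(_ m) := xF; rewrite in_violated flat_chain_flat exc.
Qed.

Let SchL : loopless (Schubert_of F).
Proof. exact: loopless_Schubert flat_chain_chain flat_chain_in0 lM. Qed.

Let SchCL : coloopless (Schubert_of F).
Proof. exact: coloopless_Schubert flat_chain_chain flat_chain_in0 clM. Qed.

(** The complement of a separator is again a cyclic flat, hence comparable to it
    when the cyclic flats form a chain. *)
Lemma Schubert_separator Y : separator (Schubert_of F) Y -> Y = set0 \/ Y = setT.
Proof.
move=> sY; have := flat_chain_chain; rewrite -SchE.
have sYC : separator (Schubert_of F) (~: Y) by rewrite separator_setC.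
move/(_ _ _ (separator_cyclic_flat SchL SchCL sY) (separator_cyclic_flat SchL SchCL sYC)).
case/orP=> sub; [left|right].
  by rewrite -[Y](setIidPl sub) setICr.
by rewrite -[Y](setUidPl sub) setUCr.
Qed.

Lemma relint_Schubert (R : realType) (x : 'rV[R]_#|E|) :
  relint (base_polytope (Schubert_of F)) x <->
  [/\ forall e, 0 < entry x e < 1, mass x setT = (rk M setT)%:R
    & [forall m, F m \notin saturated M x]].
Proof.
rewrite (relint_base_polytopeP SchL); split=> [[px xpos xsep]|[x01 xT xF]].
  split=> [e||]; last 2 first.
  - by case: px => _ _ ->; rewrite SchT.
  - apply/forallP => m; rewrite in_saturated !negb_and flat_chain_flat /= -implybE.
    apply/implyP => Fm0; rewrite -implybE; apply/implyP => FmT; rewrite -ltNge.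
    rewrite subr_lt0 -rk_Sch lt_neqAle; case: (px) => _ -> _; rewrite andbT.
    by apply/eqP => /xsep /Schubert_separator[Fm|Fm]; move: Fm0 FmT; rewrite Fm eqxx.
  by rewrite xpos (tight_separator_lt1 SchL SchCL px xsep).
have x01' e : 0 <= entry x e <= 1 by have /andP[/ltW-> /ltW->] := x01 e.
have ends m : 0 <= excess M x (F m) -> F m = set0 \/ F m = setT.
  move=> exc; have /forallP/(_ m) := xF; rewrite in_saturated flat_chain_flat exc /= andbT.
  by rewrite negb_and !negbK => /orP[/eqP->|/eqP->]; [left|right].
have px : rank_polytope (Schubert_of F) x.
  apply/base_polytopeP/base_polytope_Schubert; split=> //; apply/forallP => m.
  rewrite in_violated flat_chain_flat /=; apply/negP => exc.
  by have := exc; case: (ends m (ltW exc)) => ->; rewrite /excess ?mass0 ?rk0 ?xT subrr ltxx.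
split=> // [e|X tX]; first by have /andP[] := x01 e.
have : X \in cyclic_flats (Schubert_of F).
  apply: max_excess_cyclic_flat x01 _ => B; have [_ leB _] := px.
  by rewrite /excess tX subrr subr_le0.
rewrite SchE => /imsetP[m _ eX]; rewrite eX in tX *.
case: (ends m); first by rewrite /excess tX rk_Sch subrr.
  by move=> ->; apply: separator0.
by move=> ->; apply: separatorT.
Qed.

End FlatChain.


(** A chain of cyclic flats of nonzero weight has strictly increasing ranks, so
    it visits each block at most once. *)
Lemma chain_sum_vanish (V : {set {set E}}) Y : set0 \notin V ->
  chain_sum (flat_weight M) (avoiding M V) #|P| Y = 0.
Proof.
move=> V0; rewrite /chain_sum big1 // => F /andP[]; rewrite chain_in_avoiding //.
move=> /andP[Fflats _] _; apply/eqP; apply: contraT => wF.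
have inj : injective (fun m => block_index (F m)).
  move=> m l eq_ml; apply: val_inj; apply/eqP; apply: contraT; rewrite neq_ltn.
  have lt_rk (a b : 'I_#|P|.+1) : (a < b)%N -> block_index (F a) != block_index (F b).
    move=> ltab; have Fa := flat_chain_flat Fflats a; have Fb := flat_chain_flat Fflats b.
    apply: contraTneq (rk_cyclic_flat_lt Fa (weight_neq0_proper wF ltab)) => eqab.
    have Fai : F a \in block (block_index (F a)) by rewrite -block_indexP.
    have Fbi : F b \in block (block_index (F a)) by rewrite eqab -block_indexP.
    by have [-> _] := block_uniform Fai Fbi; rewrite ltnn.
  by case/orP=> /lt_rk; rewrite eq_ml eqxx.
by have := leq_card _ inj; rewrite !card_ord ltnn.
Qed.

Lemma block_set0 i : set0 \in block i -> block i = [set set0].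
Proof.
move=> i0; apply/setP => X; rewrite inE; apply/idP/eqP => [Xi|->//].
by apply/eqP; rewrite -cards_eq0; have [_ ->] := block_uniform Xi i0; rewrite cards0.
Qed.

Lemma block_setT i : setT \in block i -> block i = [set setT].
Proof.
move=> iT; apply/setP => X; rewrite inE; apply/idP/eqP => [Xi|->//].
by apply/eqP; rewrite eqEcard subsetT /=; have [_ ->] := block_uniform Xi iT.
Qed.

Lemma flat_chain_block_chain k (F : {ffun 'I_k.+1 -> {set E}}) (B : {ffun 'I_k.+1 -> 'I_#|P|}) :
  F ord0 = set0 -> F ord_max = setT -> weight (flat_weight M) F != 0 ->
  (forall m, F m \in block (B m)) -> block_chain B.
Proof.
move=> F0 FT wF FB; apply/and3P; split.
- by apply/eqP/block_set0; rewrite -F0 FB.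
- by apply/eqP/block_setT; rewrite -FT FB.
apply/forallP => m; set a := widen_ord _ m; set b := lift ord0 m.
have ab : F a \proper F b by apply: (weight_neq0_proper wF); rewrite /= /bump.
rewrite /block_lt -/(block (B a)) -/(block (B b)); apply/andP; split.
  have := rk_cyclic_flat_lt (block_sub (FB a)) ab; apply: contraTneq => eqab.
  have Fba : F b \in block (B a) by rewrite eqab FB.
  by have [-> _] := block_uniform (FB a) Fba; rewrite ltnn.
by rewrite (incidenceE _ (FB b)); apply/card_gt0P; exists (F a); rewrite inE FB proper_sub.
Qed.

(** Chains of cyclic flats lying in the same blocks have isomorphic Schubert
    matroids, and their weights add up to the weight of the chain of blocks. *)
Lemma Schubert_sum_flats (R : realType) (G : zmodType)
    (Psi : forall S : finType, matroid S -> G) : isomorphism_invariant Psi ->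
  Schubert_sum Psi M P =
  \sum_(k < #|P|) \sum_(F : {ffun 'I_k.+1 -> {set E}} |
      chain_in (avoiding M set0) F && (F ord_max == setT))
    Psi E (Schubert_of F) *~ weight (flat_weight M) F.
Proof.
move=> isoPsi; apply: eq_bigr => -[k ltk] _ /=; rewrite big_mkcond /=.
pose ind (F : {ffun 'I_k.+1 -> {set E}}) : {ffun 'I_k.+1 -> 'I_#|P|} :=
  [ffun m => block_index (F m)].
rewrite [RHS](partition_big ind xpredT) //=; apply: eq_bigr => B _.
have indP F : chain_in (avoiding M set0) F -> (ind F == B) = [forall m, F m \in block (B m)].
  move=> Fflats; apply/eqP/forallP => [<- m|FB].
    by have FZ := flat_chain_flat Fflats m; rewrite ffunE -block_indexP.
  apply/ffunP => m; have FZ := flat_chain_flat Fflats m.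
  by rewrite ffunE; apply/eqP; rewrite block_indexP ?FB.
case: ifP => [chB|nchB]; last first.
  rewrite big1 // => F /andP[/andP[Fflats /eqP FT]].
  rewrite indP // => /forallP FB; have [->|wF] := eqVneq (weight (flat_weight M) F) 0.
    exact: mulr0z.
  by rewrite (flat_chain_block_chain (flat_chain0 Fflats) FT wF FB) in nchB.
have /and3P[/eqP B0 /eqP BT _] := chB.
rewrite -(chain_sum_weight chB) mulrz_sumr; apply: eq_big => [F|F].
  rewrite chain_in_blocks; apply/andP/andP => [[/forallP FB FT]|[/andP[Fflats FT]]].
    have Fflats : chain_in (avoiding M set0) F.
      apply/forallP => m; case em: (nat_of_ord m) => [|l] /=.
        have -> : m = ord0 by apply: val_inj.
        by have := FB ord0; rewrite /block B0.
      by rewrite setD0 (block_sub (FB m)).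
    by rewrite Fflats FT indP //; split=> //; apply/forallP.
  by rewrite indP.
move=> /andP[]; rewrite chain_in_blocks => /forallP FB /eqP FT.
have [->|wF] := eqVneq (weight (flat_weight M) F) 0; first by rewrite !mulr0z.
have F0 : F ord0 = set0 by have := FB ord0; rewrite /block B0 inE => /eqP.
have Fflats : chain_in (avoiding M set0) F.
  apply/forallP => m; case em: (nat_of_ord m) => [|l] /=.
    by have -> : m = ord0 by [apply: val_inj]; rewrite F0 inE.
  by rewrite setD0 (block_sub (FB m)).
congr (_ *~ _); have SF := is_Schubert_of Fflats FT wF (fun m => block_cardE (FB m))
                                         (fun m => block_rkE (FB m)).
rewrite /Schubert; case: pickP => [N SN /=|/(_ (Schubert_of F))]; last by rewrite SF.
have [|f isof] := is_Schubert_iso R SN SF; last exact: isoPsi isof.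
by rewrite (block_cardE (FB ord_max)) FT cardsT.
Qed.

(** * Linear relations *)

Section Relation.
Variable s : int.

(** Valuations are tested on finite families of matroids. Collecting the terms
    that belong to the same matroid N turns the double sum over chains into a
    family indexed by all matroids on E. *)
Definition coefficient (N : matroid E) : int :=
  (N == M)%:R * s - \sum_(k < #|P|) \sum_(F : {ffun 'I_k.+1 -> {set E}} |
      chain_in (avoiding M set0) F && (F ord_max == setT))
    (Schubert_of F == N)%:R * weight (flat_weight M) F.

Lemma sum_coefficient (G : zmodType) (phi : matroid E -> G) :
  \sum_N phi N *~ coefficient N = phi M *~ s -
  \sum_(k < #|P|) \sum_(F : {ffun 'I_k.+1 -> {set E}} |
      chain_in (avoiding M set0) F && (F ord_max == setT))
    phi (Schubert_of F) *~ weight (flat_weight M) F.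
Proof.
have pick_term N0 (c : int) : \sum_N phi N *~ ((N0 == N)%:R * c) = phi N0 *~ c.
  rewrite (bigD1 N0) //= eqxx mul1r big1 ?addr0 // => N /negPf.
  by rewrite eq_sym => ->; rewrite mul0r mulr0z.
under eq_bigr do rewrite mulrzBr eq_sym.
rewrite sumrB pick_term; congr (_ - _).
under eq_bigr do rewrite mulrz_sumr.
rewrite exchange_big; apply: eq_bigr => k _ /=.
under eq_bigr do rewrite mulrz_sumr.
by rewrite exchange_big; apply: eq_bigr => F _ /=.
Qed.

Lemma sum_coefficient_ord (G : zmodType) (phi : matroid E -> G) :
  \sum_(i < #|{: matroid E}|) phi (enum_val i) *~ coefficient (enum_val i) =
  \sum_N phi N *~ coefficient N.
Proof. by rewrite [RHS](reindex _ (onW_bij _ (@enum_val_bij (matroid E)))). Qed.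

End Relation.

Lemma indic_reflect (R : realType) (T : Type) (A : classical_sets.set T) (x : T) (b : bool) :
  (A x <-> b) -> numfun.indic A x = b%:R :> R.
Proof.
move=> Ab; rewrite numfun.indicE; congr (_%:R); congr nat_of_bool.
by apply/idP/idP => [/classical_sets.set_mem/Ab|/Ab/classical_sets.mem_set].
Qed.

(** Whether a point belongs to a Schubert matroid is decided flat by flat, so the
    point only sees the family V of the flats that it forbids; b collects the
    conditions that do not depend on the chain. *)
Lemma sum_indic_avoiding (R : realType) (V : {set {set E}}) (b : bool) (x : 'rV[R]_#|E|)
    (S : matroid E -> classical_sets.set 'rV[R]_#|E|) : set0 \notin V ->
  (forall k (F : {ffun 'I_k.+1 -> {set E}}), chain_in (avoiding M set0) F ->
    F ord_max = setT -> weight (flat_weight M) F != 0 ->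
    (S (Schubert_of F) x <-> b && [forall m, F m \notin V])) ->
  \sum_(k < #|P|) \sum_(F : {ffun 'I_k.+1 -> {set E}} |
      chain_in (avoiding M set0) F && (F ord_max == setT))
    numfun.indic (S (Schubert_of F)) x *~ weight (flat_weight M) F =
  (if b then avoiding_sum M V #|P| setT else 0)%:~R :> R.
Proof.
move=> V0 SV; transitivity ((\sum_(k < #|P|) if b then
    chain_sum (flat_weight M) (avoiding M V) k setT else 0)%:~R : R); last first.
  by congr (_%:~R); case: b {SV} => //; rewrite big1.
rewrite rmorph_sum; apply: eq_bigr => k _; case: b SV => SV; last first.
  rewrite big1 // => F /andP[Fflats /eqP FT].
  have [->|wF] := eqVneq (weight (flat_weight M) F) 0; first exact: mulr0z.
  by rewrite (indic_reflect R (SV _ F Fflats FT wF)) mul0rz.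
rewrite /chain_sum rmorph_sum big_mkcond [RHS]big_mkcond; apply: eq_bigr => F _ /=.
rewrite [chain_in (avoiding M V) F]chain_in_avoiding // andbAC; case: ifP => //= /andP[Fflats /eqP FT].
have [->|wF] := eqVneq (weight (flat_weight M) F) 0; first by rewrite mulr0z if_same.
rewrite (indic_reflect R (SV _ F Fflats FT wF)) /=.
by case: ifP => _; rewrite ?mul0rz.
Qed.

Lemma set0_violated (R : realType) (x : 'rV[R]_#|E|) : set0 \notin violated M x.
Proof. by rewrite in_violated /excess mass0 rk0 subrr ltxx andbF. Qed.

Lemma set0_saturated (R : realType) (x : 'rV[R]_#|E|) : set0 \notin saturated M x.
Proof. by rewrite in_saturated eqxx andbF. Qed.

Lemma base_polytope_relation (R : realType) (x : 'rV[R]_#|E|) :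
  \sum_N numfun.indic (base_polytope N) x *~ coefficient 1 N = 0 :> R.
Proof.
rewrite sum_coefficient.
pose b := [forall e, 0 <= entry x e <= 1] && (mass x setT == (rk M setT)%:R).
rewrite (@sum_indic_avoiding R (violated M x) b) ?set0_violated //; last first.
  move=> k F Fflats FT wF; rewrite base_polytope_Schubert //; split.
    by move=> [/forallP x01 /eqP xT FV]; rewrite /b x01 xT FV.
  by move=> /andP[/andP[/forallP x01 /eqP xT] FV].
rewrite (@indic_reflect R _ _ _ (b && (violated M x == set0))); last first.
  rewrite base_polytopeP rank_polytopeP; split.
    move=> [/forallP x01 /eqP xT xF]; rewrite /b x01 xT /=; apply/eqP/setP => F.
    rewrite in_violated in_set0; case FZ: (F \in _) => //=.
    by rewrite subr_gt0 ltNge xF.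
  move=> /andP[/andP[/forallP x01 /eqP xT] /eqP Ve]; split=> // F FZ.
  have : F \notin violated M x by rewrite Ve in_set0.
  by rewrite in_violated FZ /= -leNgt subr_le0.
case: (boolP b) => [/andP[/forallP x01 /eqP xT]|_]; last by rewrite mul0rz subrr.
rewrite (avoiding_violated lM clM xT x01) => [|Y]; last exact/chain_sum_vanish/set0_violated.
by rewrite mulr1z; case: (_ == _); rewrite subrr.
Qed.

Lemma relint_relation (R : realType) (x : 'rV[R]_#|E|) :
  \sum_N numfun.indic (relint (base_polytope N)) x *~
    coefficient ((-1) ^+ (n_components M).-1) N = 0 :> R.
Proof.
rewrite (@sum_coefficient _ R (fun N => numfun.indic (relint (base_polytope N)) x)).
pose b := [forall e, 0 < entry x e < 1] && (mass x setT == (rk M setT)%:R).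
rewrite (@sum_indic_avoiding R (saturated M x) b x (fun N => relint (base_polytope N)))
  ?set0_saturated //; last first.
  move=> k F Fflats FT wF; rewrite relint_Schubert //; split.
    by move=> [/forallP x01 /eqP xT FV]; rewrite /b x01 xT FV.
  by move=> /andP[/andP[/forallP x01 /eqP xT] FV].
rewrite (@indic_reflect R _ _ _ (b && relint_condition M x)); last first.
  rewrite (relint_base_polytopeP lM); split.
    move=> [px xpos xsep]; have [_ xA xT] := px; apply/andP; split; last first.
      by apply/forallP => A; rewrite xA; apply/implyP => /eqP/xsep.
    rewrite /b xT eqxx andbT; apply/forallP => e.
    by rewrite xpos (tight_separator_lt1 lM clM px xsep).
  move=> /andP[/andP[/forallP x01 /eqP xT] /forallP cond]; split=> [|e|A tA].
  - split=> // [e|A]; first by have /andP[/ltW] := x01 e.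
    by have /andP[] := cond A.
  - by have /andP[] := x01 e.
  by have /andP[_] := cond A; rewrite tA eqxx.
case: (boolP b) => [/andP[/forallP x01 /eqP xT]|_]; last by rewrite mul0rz subrr.
rewrite (avoiding_saturated lM clM xT x01) => [|Y]; last exact/chain_sum_vanish/set0_saturated.
by case: relint_condition; rewrite ?mulr1 ?mulr0 ?mul0rz subrr.
Qed.

End Blocks.

(* The exponent is the truncated predecessor: it is c(M) - 1 whenever the ground
   set is nonempty, and 0 for the matroid on the empty ground set. *)
Theorem corollary3p3 (R : realType) (G : zmodType) (E : finType)
    (M : matroid E) (P : {set {set {set E}}})
    (Psi : forall S : finType, matroid S -> G) :
  loopless M -> coloopless M -> condensation M P ->
  (covaluative_invariant R Psi ->
     Psi E M = Schubert_sum Psi M P *~ (-1) ^+ (n_components M).-1)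
  /\
  (connected M ->
     valuative_invariant R Psi \/ covaluative_invariant R Psi ->
     Psi E M = Schubert_sum Psi M P).
Proof.
move=> lM clM condP.
have co : covaluative_invariant R Psi ->
    Psi E M = Schubert_sum Psi M P *~ (-1) ^+ (n_components M).-1.
  move=> [isoPsi covPsi]; set s := (-1) ^+ _.
  have ss : s * s = 1 by rewrite -expr2 sqrr_sign.
  have := covPsi E #|{: matroid E}| enum_val (fun i => coefficient M P s (enum_val i)).
  rewrite (sum_coefficient_ord M P s (Psi E)) sum_coefficient.
  rewrite -(Schubert_sum_flats lM clM condP R isoPsi).
  move=> rel; rewrite -[LHS]mulr1z -ss mulrzA; congr (_ *~ s); apply/eqP.
  rewrite -subr_eq0; apply/eqP/rel => x; rewrite -[RHS](relint_relation lM clM condP x).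
  rewrite -(sum_coefficient_ord M P s (fun N => numfun.indic (relint (base_polytope N)) x)).
  by apply: eq_bigr => i _; rewrite mulrC mulrzr.
split=> // conM [[isoPsi valPsi]|/co ->]; last first.
  suff -> : (n_components M).-1 = 0%N by rewrite expr0 mulr1z.
  by move: conM; rewrite /connected; case: (n_components M) => [|[]].
have := valPsi E #|{: matroid E}| enum_val (fun i => coefficient M P 1 (enum_val i)).
rewrite (sum_coefficient_ord M P 1 (Psi E)) sum_coefficient.
rewrite -(Schubert_sum_flats lM clM condP R isoPsi).
move=> rel; apply/eqP; rewrite -subr_eq0 -[X in X - _]mulr1z; apply/eqP/rel => x.
rewrite -[RHS](base_polytope_relation lM clM condP x).
rewrite -(sum_coefficient_ord M P 1 (fun N => numfun.indic (base_polytope N) x)).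
by apply: eq_bigr => i _; rewrite mulrC mulrzr.
Qed.
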